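(* Let $E,F$ be real Banach lattices such that $E^*$ has order continuous norm, and let $\varphi\colon E^*\to F^*$ be a lattice isomorphism. Then for every $n\in\mathbb{N}$ and every Dedekind complete Banach lattice $G$, the map $\overline{\varphi}\colon \mathcal{P}^r(^nE;G)\to\mathcal{P}^r(^nF;G^{**})$ is a positive linear operator which is a linear isomorphism onto its image.
   Context: For Banach lattices $E,G$, an $n$-homogeneous polynomial $P\colon E\to G$ is positive if its associated symmetric $n$-linear map $T_P\colon E^n\to G$ is positive (nonnegative on tuples of nonnegative vectors); $\mathcal{P}^r(^nE;G)$ denotes the space of regular $n$-homogeneous polynomials (differences of positive ones), ordered by the cone of positive polynomials; when $G$ is Dedekind complete it is a Banach lattice with the regular norm $\|P\|_r=\||P|\|$. For a bounded $n$-linear form $B\colon E^n\to\mathbb{R}$, $\overline{B}\colon (E^{**})^n\to\mathbb{R}$ denotes its Arens (Aron–Berner) extension: $\overline{B}(x_1^{**},\dots,x_n^{**})=\lim_{\alpha_1}\cdots\lim_{\alpha_n}B(x_{1,\alpha_1},\dots,x_{n,\alpha_n})$ where $x_{i,\alpha_i}\to x_i^{**}$ weak$^*$, the limit in the first variable being the outermost. $J_F\colon F\to F^{**}$ is the canonical embedding and $\varphi^*\colon F^{**}\to E^{**}$ is the adjoint of $\varphi$. For $P\in\mathcal{P}(^nE;G)$, define $\overline{\varphi}(P)\colon F\to G^{**}$ by $\overline{\varphi}(P)(y)(z^* )=\overline{z^*\circ T_P}\big(\varphi^*(J_F(y)),\dots,\varphi^*(J_F(y))\big)$ for $y\in F$,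 $z^*\in G^*$. *)

(* Defs.v *)
From HB Require Import structures.
From mathcomp Require Import all_boot all_order all_algebra.
From mathcomp Require Import all_classical all_reals all_analysis.
From Stdlib Require Import ClassicalEpsilon.
Set Implicit Arguments. Unset Strict Implicit. Unset Printing Implicit Defensive.
Import Order.TTheory GRing.Theory Num.Theory.
Import numFieldNormedType.Exports.
Local Open Scope ring_scope.
Local Open Scope classical_set_scope.

Section BanachLattice.
Variable R : realType.

Definition is_lub_in {T : Type} (S : set T) (le : T -> T -> Prop)
    (A : set T) (s : T) : Prop :=
  S s /\ (forall a, A a -> le a s) /\
  (forall u, S u -> (forall a, A a -> le a u) -> le s u).

Definition is_lub {T : Type} (le : T -> T -> Prop) (A : set T) (s : T) :=
  is_lub_in setT le A s.

Definition banach_lattice (V : completeNormedModType R) (le : V -> V -> Prop)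
  : Prop :=
  (forall x, le x x) /\
  (forall x y, le x y -> le y x -> x = y) /\
  (forall x y z, le x y -> le y z -> le x z) /\
  (forall x y z, le x y -> le (x + z) (y + z)) /\
  (forall (a : R) x, 0 <= a -> le 0 x -> le 0 (a *: x)) /\
  (forall x y, exists s, is_lub le [set x; y] s) /\
  (forall x y ax ay, is_lub le [set x; - x] ax -> is_lub le [set y; - y] ay ->
     le ax ay -> `|x| <= `|y|).

Definition dedekind_complete {V : Type} (le : V -> V -> Prop) : Prop :=
  forall A : set V, A !=set0 -> (exists u, forall a, A a -> le a u) ->
    exists s, is_lub le A s.

Definition dual (V : normedModType R) : set (V -> R) :=
  [set f | (forall (a : R) x y, f (a *: x + y) = a * f x + f y) /\ continuous f].

Arguments dual : clear implicits.

Definition dual_le (V : normedModType R) (le : V -> V -> Prop)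
    (f g : V -> R) : Prop :=
  forall x, le 0 x -> f x <= g x.

Definition dual_norm (V : normedModType R) (f : V -> R) : R :=
  sup [set `|f x| | x in [set x : V | `|x| <= 1]].

Definition dual_order_continuous (V : normedModType R) (le : V -> V -> Prop)
  : Prop :=
  forall (I : Type) (leI : I -> I -> Prop) (f : I -> V -> R),
    (forall i, leI i i) ->
    (forall i j k, leI i j -> leI j k -> leI i k) ->
    (forall i j, exists k, leI i k /\ leI j k) ->
    (forall i, dual V (f i)) ->
    (forall i j, leI i j -> dual_le le (f j) (f i)) ->
    is_lub_in (dual V) (fun g h => dual_le le h g) (range f) (fun _ => 0) ->
    forall e : R, 0 < e -> exists i, forall j, leI i j -> dual_norm (f j) < e.

Definition lattice_iso (E F : normedModType R) (leE : E -> E -> Prop)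
    (leF : F -> F -> Prop) (phi : (E -> R) -> (F -> R)) : Prop :=
  [/\ (forall f, dual E f -> dual F (phi f)),
      (forall (a : R) f g, dual E f -> dual E g ->
         phi (fun x => a * f x + g x) = (fun y => a * phi f y + phi g y)),
      (forall f g, dual E f -> dual E g -> phi f = phi g -> f = g),
      (forall h, dual F h -> exists2 f, dual E f & phi f = h) &
      (forall f g s, dual E f -> dual E g ->
         is_lub_in (dual E) (dual_le leE) [set f; g] s ->
         is_lub_in (dual F) (dual_le leF) [set phi f; phi g] (phi s))].

(* An n-linear map V^n -> W is represented as a function on sequences,
   meaningful on sequences of size n. *)
Section Poly.
Variables (V : normedModType R) (W : normedModType R).

Definition multilinear (n : nat) (T : seq V -> W) : Prop :=
  forall s, size s = n -> forall i, (i < n)%N -> forall (a : R) x y,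
    T (set_nth 0 s i (a *: x + y)) =
      a *: T (set_nth 0 s i x) + T (set_nth 0 s i y).

Definition bounded_multi (n : nat) (T : seq V -> W) : Prop :=
  exists C : R, forall s, size s = n -> `|T s| <= C * \prod_(x <- s) `|x|.

Definition symmetric_multi (n : nat) (T : seq V -> W) : Prop :=
  forall s t, size s = n -> perm_eq s t -> T s = T t.

Definition homog_poly (n : nat) (P : V -> W) : Prop :=
  exists T, [/\ multilinear n T, bounded_multi n T & forall x, P x = T (nseq n x)].

Definition is_sym_assoc (n : nat) (P : V -> W) (T : seq V -> W) : Prop :=
  [/\ multilinear n T, bounded_multi n T, symmetric_multi n T &
      forall x, P x = T (nseq n x)].

Definition TP (n : nat) (P : V -> W) : seq V -> W :=
  epsilon (inhabits (fun _ => 0)) (is_sym_assoc n P).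

Definition pos_poly (leV : V -> V -> Prop) (leW : W -> W -> Prop)
    (n : nat) (P : V -> W) : Prop :=
  homog_poly n P /\
  forall s, size s = n -> (forall x, x \in s -> leV 0 x) -> leW 0 (TP n P s).

Definition regular_poly (leV : V -> V -> Prop) (leW : W -> W -> Prop)
    (n : nat) (P : V -> W) : Prop :=
  exists P1 P2, [/\ pos_poly leV leW n P1, pos_poly leV leW n P2 &
                    forall x, P x = P1 x - P2 x].
End Poly.

(* An element of G^** is a functional u on G -> R, considered on G^* only:
   it must be linear and bounded on G^*, and two such are equal iff they
   agree on G^*. The order of G^** is the dual order of the dual order. *)
Section BidualPoly.
Variables (V : normedModType R) (G : normedModType R).

Definition bidual (u : (G -> R) -> R) : Prop :=
  (forall (a : R) z w, dual G z -> dual G w ->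
      u (fun x => a * z x + w x) = a * u z + u w) /\
  exists C : R, forall z, dual G z -> `|u z| <= C * dual_norm z.

Definition beq (u v : (G -> R) -> R) : Prop := forall z, dual G z -> u z = v z.

Definition bidual_nonneg (leG : G -> G -> Prop) (u : (G -> R) -> R) : Prop :=
  forall z, dual G z -> dual_le leG (fun _ => 0) z -> 0 <= u z.

Definition multilinear2 (n : nat) (T : seq V -> (G -> R) -> R) : Prop :=
  forall s, size s = n -> bidual (T s) /\
    forall i, (i < n)%N -> forall (a : R) x y,
      beq (T (set_nth 0 s i (a *: x + y)))
          (fun z => a * T (set_nth 0 s i x) z + T (set_nth 0 s i y) z).

Definition bounded_multi2 (n : nat) (T : seq V -> (G -> R) -> R) : Prop :=
  exists C : R, forall s, size s = n -> forall z, dual G z ->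
    `|T s z| <= C * (\prod_(x <- s) `|x|) * dual_norm z.

Definition symmetric_multi2 (n : nat) (T : seq V -> (G -> R) -> R) : Prop :=
  forall s t, size s = n -> perm_eq s t -> beq (T s) (T t).

Definition homog_poly2 (n : nat) (Q : V -> (G -> R) -> R) : Prop :=
  exists T, [/\ multilinear2 n T, bounded_multi2 n T &
                forall x, beq (Q x) (T (nseq n x))].

Definition is_sym_assoc2 (n : nat) (Q : V -> (G -> R) -> R)
    (T : seq V -> (G -> R) -> R) : Prop :=
  [/\ multilinear2 n T, bounded_multi2 n T, symmetric_multi2 n T &
      forall x, beq (Q x) (T (nseq n x))].

Definition TP2 (n : nat) (Q : V -> (G -> R) -> R) : seq V -> (G -> R) -> R :=
  epsilon (inhabits (fun _ _ => 0)) (is_sym_assoc2 n Q).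

Definition pos_poly2 (leV : V -> V -> Prop) (leG : G -> G -> Prop)
    (n : nat) (Q : V -> (G -> R) -> R) : Prop :=
  homog_poly2 n Q /\
  forall s, size s = n -> (forall x, x \in s -> leV 0 x) ->
    bidual_nonneg leG (TP2 n Q s).

Definition regular_poly2 (leV : V -> V -> Prop) (leG : G -> G -> Prop)
    (n : nat) (Q : V -> (G -> R) -> R) : Prop :=
  exists Q1 Q2, [/\ pos_poly2 leV leG n Q1, pos_poly2 leV leG n Q2 &
                    forall x, beq (Q x) (fun z => Q1 x z - Q2 x z)].
End BidualPoly.

(* For an n-linear form B (on sequences) and x_1^**, ..., x_n^** in E^**
   (functionals on E -> R), the iterated weak^* limit, first variable
   outermost, unfolds to
     B-bar(x1,...,xn) = x1 ( y |-> B-bar(J y, x2, ..., xn) ). *)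
Fixpoint arens {V : Type} (B : seq V -> R) (us : seq ((V -> R) -> R)) : R :=
  match us with
  | [::] => B [::]
  | u :: us' => u (fun x => arens (fun v => B (x :: v)) us')
  end.

(* phi-bar(P)(y)(z^* ) = (z^* o T_P)-bar(phi^*(J_F y), ..., phi^*(J_F y)),
   where phi^*(J_F y)(f) = (J_F y)(phi f) = phi f y. *)
Definition phibar (E F G : normedModType R) (phi : (E -> R) -> (F -> R))
    (n : nat) (P : E -> G) : F -> (G -> R) -> R :=
  fun y z => arens (fun s => z (TP n P s)) (nseq n (fun f : E -> R => phi f y)).

End BanachLattice.

(* Main.v *)
(* Idea. A positive functional [u] on [E^*] can be approximated, uniformly on an
   order interval [0, f] of [E^*], by evaluations at positive elements of [E]: order
   continuity of the norm of [E^*] first gives [b] with [u h <= h b + e] on [0, f],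
   and then [b] is successively halved. Consequently the two Arens extensions of a
   positive bilinear form agree, so the extension of [z o T_P] is symmetric on the
   functionals [phi^* (J y)], hence determined by polarization from its diagonal
   [phibar P]. If it vanishes, the injectivity of [phi] makes the variables
   [phi^* (J y)] peel off one at a time, giving [z o T_P = 0] for all [z] in [G^*]. *)
Require Import Defs.
From HB Require Import structures.
From mathcomp Require Import all_boot all_order all_algebra all_fingroup.
From mathcomp Require Import all_classical all_reals all_analysis.
From mathcomp Require Import ring lra.
Set Implicit Arguments. Unset Strict Implicit. Unset Printing Implicit Defensive.
Import Order.TTheory GRing.Theory Num.Theory.
Import numFieldNormedType.Exports.
Local Open Scope ring_scope.
Local Open Scope classical_set_scope.

(** * Dual spaces *)

Section DualSpace.
Context {R : realType} {V : normedModType R}.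
Implicit Types (f g : V -> R) (x y : V).

(** The extension is an iterated limit, so even for a symmetric [T_P] it could depend on the order
    of the variables, and then its diagonal would not determine it. Exchanging two of the limits
    needs a single [x] in [E] that replaces [u] on all functionals occurring in one estimate.
    Weak-star density of [E] in its bidual gives no such uniformity, whence the approximation on
    whole order intervals. The other functional [v] is replaced by evaluation at some [a] only up to
    a tail, and [x] is chosen after [a]; the tail is therefore made into a functional on [E] lying
    in the same interval, so that [x] controls it too. Halving works like the computation of binary
    digits: comparing [u] with the midpoint of its current bounds splits [f] into pieces on which
    the next digit is 1, 0 or arbitrary. All this concerns positive objects. General ones are
    reached by splitting [P], the functional on [G] and the points of [F] into positive parts.
    Continuity of [phi] is derived from its positivity. *)

Lemma real_lub (A : set R) (C : R) : A !=set0 -> (forall a, A a -> a <= C) ->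
  [/\ forall a, A a -> a <= sup A,
      forall m, (forall a, A a -> a <= m) -> sup A <= m &
      forall e, 0 < e -> exists2 a, A a & sup A - e < a].
Proof.
move=> A0 AC; have hA : has_sup A by split=> //; exists C => a /AC.
split=> [a Aa|m Am|e e0]; first by apply: ub_le_sup => //; exists C => b /AC.
- by apply: ge_sup => // a /Am.
- exact: sup_adherent.
Qed.

Lemma dualP f (a : R) x y : dual f -> f (a *: x + y) = a * f x + f y.
Proof. by case. Qed.

Lemma dual0 f : dual f -> f 0 = 0.
Proof. by move=> df; have := dualP (-1) 0 0 df; rewrite scaler0 addr0; lra. Qed.

Lemma dualZ f (a : R) x : dual f -> f (a *: x) = a * f x.
Proof. by move=> df; have := dualP a x 0 df; rewrite addr0 (dual0 df) addr0. Qed.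

Lemma dualD f x y : dual f -> f (x + y) = f x + f y.
Proof. by move=> df; have := dualP 1 x y df; rewrite scale1r mul1r. Qed.

Lemma dualN f x : dual f -> f (- x) = - f x.
Proof. by move=> df; rewrite -scaleN1r dualZ // mulN1r. Qed.

Lemma dualB f x y : dual f -> f (x - y) = f x - f y.
Proof. by move=> df; rewrite dualD // dualN. Qed.

Lemma dual_intro f (C : R) : (forall (a : R) x y, f (a *: x + y) = a * f x + f y) ->
  (forall x, `|f x| <= C * `|x|) -> dual f.
Proof.
move=> fl fC; split=> //.
pose F : {linear V -> R^o} := HB.pack (f : V -> R^o)
  (GRing.isLinear.Build R V R^o *:%R f fl).
apply: (@bounded_linear_continuous _ _ _ F); apply/linear_boundedP.
near=> r => x; apply: (le_trans (fC x)); apply: ler_wpM2r => //.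
Unshelve. all: by end_near. Qed.

Lemma dual_bounded f : dual f -> exists2 C, 0 < C & forall x, `|f x| <= C * `|x|.
Proof.
case=> fl fc.
pose F : {linear V -> R^o} := HB.pack (f : V -> R^o)
  (GRing.isLinear.Build R V R^o *:%R f fl).
have /linear_boundedP : bounded_near F (nbhs 0).
  by apply/linear_bounded_continuous.
by move=> /pinfty_ex_gt0 [C C0 H]; exists C.
Qed.

Lemma dual_comb (a : R) f g : dual f -> dual g -> dual (fun x => a * f x + g x).
Proof.
move=> df dg; have [C C0 fC] := dual_bounded df; have [D D0 gD] := dual_bounded dg.
apply: (@dual_intro _ (`|a| * C + D)) => [b x y|x].
  by rewrite !dualP //; ring.
apply: (le_trans (ler_normD _ _)); rewrite normrM mulrDl -mulrA lerD //.
by rewrite ler_wpM2l.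
Qed.

Lemma dual_zero : dual (fun _ : V => 0 : R).
Proof. by apply: (@dual_intro _ 0) => [a x y|x]; rewrite ?mulr0 ?addr0 ?normr0 ?mul0r. Qed.

Lemma dual_add f g : dual f -> dual g -> dual (fun x => f x + g x).
Proof.
move=> df dg; have := dual_comb 1 df dg.
by congr dual; apply/funext => x; rewrite mul1r.
Qed.

Lemma dual_sub f g : dual f -> dual g -> dual (fun x => f x - g x).
Proof.
move=> df dg; have := dual_comb (-1) dg df.
by congr dual; apply/funext => x; rewrite mulN1r addrC.
Qed.

Lemma dual_scale (a : R) f : dual f -> dual (fun x => a * f x).
Proof.
move=> df; have := dual_comb a df dual_zero.
by congr dual; apply/funext => x; rewrite addr0.
Qed.

(** Trades the supremum in [dual_norm] for Lipschitz bounds, the form in which later estimates are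
    made. *)
Lemma dual_norm_lub f : dual f ->
  (forall x, `|f x| <= dual_norm f * `|x|) /\
  (forall M, 0 <= M -> (forall x, `|f x| <= M * `|x|) -> dual_norm f <= M).
Proof.
move=> df; have [C C0 fC] := dual_bounded df.
have [] := @real_lub [set `|f x| | x in [set x : V | `|x| <= 1]] C.
- by exists `|f 0|; exists 0 => //=; rewrite normr0.
- move=> _ [x /= x1 <-]; apply: (le_trans (fC x)).
  by rewrite -[leRHS]mulr1 ler_wpM2l // ltW.
rewrite -/(dual_norm f) => ub lub _; split=> [x|M M0 fM].
  have [->|x0] := eqVneq x 0; first by rewrite dual0 // !normr0 mulr0.
  have nx : 0 < `|x| by rewrite normr_gt0.
  rewrite -ler_pdivrMr //; apply: ub; exists (`|x|^-1 *: x) => /=.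
    by rewrite normrZ normfV normr_id mulVf // gt_eqF.
  by rewrite dualZ // normrM normfV normr_id mulrC.
apply: lub => _ [x /= x1 <-]; apply: (le_trans (fM x)).
by rewrite -[leRHS]mulr1 ler_wpM2l.
Qed.

Lemma dual_norm_ge0 f : dual f -> 0 <= dual_norm f.
Proof.
move=> df; have [C C0 fC] := dual_bounded df.
have [||ub _ _] := @real_lub [set `|f x| | x in [set x : V | `|x| <= 1]] C.
- by exists `|f 0|; exists 0 => //=; rewrite normr0.
- move=> _ [x /= x1 <-]; apply: (le_trans (fC x)).
  by rewrite -[leRHS]mulr1 ler_wpM2l // ltW.
by apply: le_trans (ub `|f 0| _); rewrite ?normr_ge0 //; exists 0 => //=; rewrite normr0.
Qed.

End DualSpace.

(** * Banach lattices and their duals *)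

Section BanachLattice.
Context {R : realType} {V : completeNormedModType R} {le : V -> V -> Prop}.
Hypothesis HV : banach_lattice le.
Implicit Types (x y z : V) (f g h : V -> R).
Local Notation dle := (dual_le le).

Lemma cone_le_refl x : le x x. Proof. by have [+ _] := HV. Qed.

Lemma cone_le_trans y x z : le x y -> le y z -> le x z.
Proof. by have [_ [_ [+ _]]] := HV; exact. Qed.

Lemma le_add2r z x y : le x y -> le (x + z) (y + z).
Proof. by have [_ [_ [_ [+ _]]]] := HV; exact. Qed.

Lemma le_scale (a : R) x : 0 <= a -> le 0 x -> le 0 (a *: x).
Proof. by have [_ [_ [_ [_ [+ _]]]]] := HV; exact. Qed.

Lemma le_subr_ge0 x y : le 0 (y - x) <-> le x y.
Proof.
split=> [/(le_add2r x)|/(le_add2r (- x))]; first by rewrite add0r subrK.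
by rewrite subrr.
Qed.

Lemma le_add x y z t : le x y -> le z t -> le (x + z) (y + t).
Proof.
move=> /(le_add2r z) xy /(le_add2r y); rewrite ![_ + y]addrC; exact: cone_le_trans.
Qed.

Lemma le_add_ge0 x y : le 0 x -> le 0 y -> le 0 (x + y).
Proof. by move=> x0 y0; rewrite -[0]addr0; exact: le_add. Qed.

Lemma join_exists x y :
  exists s, [/\ le x s, le y s & forall u, le x u -> le y u -> le s u].
Proof.
have [_ [_ [_ [_ [_ [+ _]]]]]] := HV => /(_ x y) [s [_ [ub lub]]].
exists s; split; [by apply: ub; left|by apply: ub; right|].
by move=> u xu yu; apply: lub => // a [->|->].
Qed.

Lemma norm_le_abs x y ax ay : is_lub le [set x; - x] ax ->
  is_lub le [set y; - y] ay -> le ax ay -> `|x| <= `|y|.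
Proof. by have [_ [_ [_ [_ [_ [_ +]]]]]] := HV; exact. Qed.

Lemma abs_ge0 x : le 0 x -> is_lub le [set x; - x] x.
Proof.
move=> x0; split=> //; split; last by move=> u _; apply; left.
move=> _ [->|->]; first exact: cone_le_refl.
by apply/le_subr_ge0; rewrite opprK; exact: le_add_ge0.
Qed.

Lemma norm_mono x y : le 0 x -> le x y -> `|x| <= `|y|.
Proof.
move=> x0 xy; have y0 := cone_le_trans x0 xy.
exact: norm_le_abs (abs_ge0 x0) (abs_ge0 y0) xy.
Qed.

Lemma pos_neg_parts x : exists p q,
  [/\ x = p - q, le 0 p, le 0 q, `|p| <= `|x| & `|q| <= `|x|].
Proof.
have [p [xp p0 plub]] := join_exists x 0.
have [ax [x1 x2 axlub]] := join_exists x (- x).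
have axP : is_lub le [set x; - x] ax.
  by split=> //; split=> [_ [->|->]//|u _ H]; apply: axlub; apply: H; [left|right].
have ax0 : le 0 ax.
  (* [ax + ax] dominates [x - x = 0]; halving gives [ax >= 0]. *)
  have := @le_scale 2^-1 (ax + ax).
  rewrite scalerDr -scalerDl (_ : 2^-1 + 2^-1 = 1 :> R); last by field.
  by rewrite scale1r; apply=> //; rewrite -(subrr x); exact: le_add.
have q0 : le 0 (p - x) by apply/le_subr_ge0.
exists p, (p - x); split=> //; first by rewrite opprB addrC subrK.
  by apply: norm_le_abs (abs_ge0 p0) axP _; exact: plub.
apply: norm_le_abs (abs_ge0 q0) axP _.
suff /(le_add2r (- x)) : le p (ax + x) by rewrite addrK.
apply: plub; first by rewrite -[x in le x _]add0r; exact: le_add2r.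
by rewrite -(addNr x); exact: le_add2r.
Qed.

(** The second piece is the positive part of [z - x], which makes the first one the meet of [z] and
    [x]. *)
Lemma riesz_decomposition x y z : le 0 x -> le 0 y -> le 0 z -> le z (x + y) ->
  exists z1 z2, [/\ z = z1 + z2, le 0 z1, le z1 x, le 0 z2 & le z2 y].
Proof.
move=> x0 y0 z0 zxy; have [s [zs s0 slub]] := join_exists (z - x) 0.
exists (z - s), s; split=> //; first by rewrite subrK.
- apply/le_subr_ge0; apply: slub => //; apply/le_subr_ge0.
  by rewrite opprB addrC subrK.
- apply/le_subr_ge0; move/le_subr_ge0 : zs.
  by congr le; rewrite !opprB addrCA.
- apply: slub => //; apply/le_subr_ge0; move/le_subr_ge0 : zxy.
  by congr le; rewrite opprB addrA (addrC y).
Qed.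

Lemma dual_ge0_mono f x y : dual f -> dle (fun _ => 0) f -> le x y -> f x <= f y.
Proof. by move=> df f0 /le_subr_ge0/f0; rewrite dualB // subr_ge0. Qed.

Lemma dual_eq_cone f g : dual f -> dual g -> (forall x, le 0 x -> f x = g x) -> f = g.
Proof.
move=> df dg fg; apply/funext => x; have [p [q [-> p0 q0 _ _]]] := pos_neg_parts x.
by rewrite !dualB // !fg.
Qed.

Lemma dual_ge0_bound f M : dual f -> dle (fun _ => 0) f ->
  (forall x, le 0 x -> f x <= M * `|x|) -> 0 <= M -> forall x, `|f x| <= M * `|x|.
Proof.
move=> df f0 fM M0 x; have [p [q [xE p0 q0 px qx]]] := pos_neg_parts x.
have h1 : f p <= M * `|x| by apply: (le_trans (fM _ p0)); rewrite ler_wpM2l.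
have h2 : f q <= M * `|x| by apply: (le_trans (fM _ q0)); rewrite ler_wpM2l.
have := f0 p p0; have := f0 q q0; rewrite xE dualB // -xE => ? ?.
by rewrite ler_norml; apply/andP; split; lra.
Qed.

(* [a |-> F (a *: x) - a * F x] is additive, vanishes at [1] and is bounded on
   [0, 1], hence bounded; an additive bounded function of a real is zero. *)
Lemma additive_bounded_homogeneous (F : V -> R) (C : R) :
  (forall x y, F (x + y) = F x + F y) -> (forall x, `|F x| <= C * `|x|) ->
  forall a x, F (a *: x) = a * F x.
Proof.
move=> FD FC a x; pose r (b : R) := F (b *: x) - b * F x.
have rD b c : r (b + c) = r b + r c by rewrite /r scalerDl FD; ring.
have r1 : r 1 = 0 by rewrite /r scale1r mul1r subrr.
have r0 : r 0 = 0 by have := rD 0 0; rewrite addr0; lra.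
have rn (n : nat) b : r (n%:R * b) = n%:R * r b.
  elim: n => [|n IH]; first by rewrite !mul0r.
  by rewrite -[n.+1]addn1 natrD !mulrDl !mul1r rD IH.
have rpos b : 0 <= b -> `|r b| <= 2 * C * `|x|.
  move=> b0; have /andP [tb bt] := Num.Theory.truncn_itv b0.
  set n := Num.truncn b in tb bt.
  have -> : r b = r (b - n%:R).
    have := rD (b - n%:R) (n%:R * 1); rewrite rn r1 mulr0 addr0 mulr1 subrK.
    by move->.
  have c0 : 0 <= b - n%:R by rewrite subr_ge0.
  have c1 : b - n%:R <= 1 by rewrite lerBlDr -natr1 addrC in bt *; exact: ltW.
  apply: (le_trans (ler_normB _ _)).
  have cx : 0 <= C * `|x| by apply: le_trans (FC x); exact: normr_ge0.
  have -> : 2 * C * `|x| = C * `|x| + C * `|x| by ring.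
  apply: lerD; first (apply: (le_trans (FC _))).
    by rewrite normrZ (ger0_norm c0) mulrCA ler_piMl.
  by rewrite normrM (ger0_norm c0) (le_trans _ (FC x)) // ler_piMl.
have rN b : r (- b) = - r b.
  by apply/eqP; rewrite -addr_eq0 -rD addNr r0.
have rb b : `|r b| <= 2 * C * `|x|.
  have [|b0] := leP 0 b; first exact: rpos.
  by rewrite -[b]opprK rN normrN; apply: rpos; rewrite oppr_ge0 ltW.
suff : r a = 0 by rewrite /r => /eqP; rewrite subr_eq0 => /eqP.
apply/eqP; rewrite -normr_eq0 eq_le normr_ge0 andbT.
rewrite leNgt; apply/negP => ra.
have K0 : 0 <= 2 * C * `|x| / `|r a|.
  by apply: divr_ge0 => //; apply: le_trans (rb a); exact: normr_ge0.
have /andP [_ ] := Num.Theory.truncn_itv K0; rewrite ltNge => /negP; apply.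
rewrite ler_pdivlMr //; apply: le_trans (rb ((Num.truncn (2 * C * `|x| / `|r a|)).+1%:R * a)).
by rewrite rn normrM ger0_norm.
Qed.

(** Kantorovich extension to differences of positive vectors. Additivity makes the value independent
    of the decomposition, and the bound yields both continuity and real homogeneity, so a candidate
    [p] has only to be additive and bounded. *)
Lemma cone_extension (p : V -> R) (C : R) :
  (forall x y, le 0 x -> le 0 y -> p (x + y) = p x + p y) ->
  (forall x, le 0 x -> 0 <= p x <= C * `|x|) ->
  exists2 F, dual F & forall x, le 0 x -> F x = p x.
Proof.
move=> pD pC.
have [P /choice [Q PQ]] := choice pos_neg_parts.
have FE a b : le 0 a -> le 0 b -> p (P (a - b)) - p (Q (a - b)) = p a - p b.
  move=> a0 b0; have [E P0 Q0 _ _] := PQ (a - b).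
  move: (P (a - b)) (Q (a - b)) E P0 Q0 => u v E u0 v0.
  have : p (u + b) = p (a + v).
    by congr p; apply: (addIr (- b)); rewrite addrK addrAC E subrK.
  by rewrite !pD //; lra.
pose F x := p (P x) - p (Q x).
have FD x y : F (x + y) = F x + F y.
  have [Ex Px0 Qx0 _ _] := PQ x; have [Ey Py0 Qy0 _ _] := PQ y.
  rewrite /F {1 2}Ex {1 2}Ey addrACA -opprD FE; [|exact: le_add_ge0..].
  by rewrite !pD //; ring.
have FC x : `|F x| <= (2 * C) * `|x|.
  have [Ex Px0 Qx0 Pn Qn] := PQ x.
  have /andP [a1 a2] := pC _ Px0; have /andP [b1 b2] := pC _ Qx0.
  have [C0|C0] := leP 0 C.
    have := ler_wpM2l C0 Pn; have := ler_wpM2l C0 Qn => ? ?.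
    have : 0 <= C * `|x| by rewrite mulr_ge0.
    by rewrite /F ler_norml => ?; apply/andP; split; lra.
  (* A negative [C] forces every positive vector, hence every vector, to be zero. *)
  have z y : le 0 y -> `|y| = 0.
    move=> /pC /andP [h1 h2]; apply/eqP; rewrite eq_le normr_ge0 andbT.
    by have := le_trans h1 h2; rewrite nmulr_rge0.
  have [Pz Qz] := (z _ Px0, z _ Qx0).
  have x0 : x = 0.
    by rewrite Ex; move/eqP : Pz; move/eqP : Qz; rewrite !normr_eq0 => /eqP -> /eqP ->; rewrite subr0.
  by move: a1 a2 b1 b2; rewrite /F Pz Qz !mulr0 x0 normr0 mulr0 normr_le0 => *; apply/eqP; lra.
exists F => [|x x0]; last first.
  by have := FE x 0 x0 (cone_le_refl _); rewrite subr0 -/(F x) => ->;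
     have := pD 0 0 (cone_le_refl _) (cone_le_refl _); rewrite addr0; lra.
apply: (@dual_intro _ _ _ (2 * C)) => // a x y.
by rewrite FD (additive_bounded_homogeneous FD FC).
Qed.

(** Riesz-Kantorovich formula: at [x >= 0] the value is the supremum of [f] over [[0, x]]. The near
    attainment in the last clause also encodes that [g] is the least positive majorant of [f]:
    compare at [y]. *)
Lemma dual_pos_part f : dual f -> exists2 g, dual g &
  [/\ dle (fun _ => 0) g, dle f g &
   forall x e, le 0 x -> 0 < e -> exists y, [/\ le 0 y, le y x & g x <= f y + e]].
Proof.
move=> df; have [C C0 fC] := dual_bounded df.
pose A x := [set f y | y in [set y | le 0 y /\ le y x]].
have AP x : le 0 x -> [/\ forall a, A x a -> a <= sup (A x),
      forall m, (forall a, A x a -> a <= m) -> sup (A x) <= m &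
      forall e, 0 < e -> exists2 a, A x a & sup (A x) - e < a].
  move=> x0; apply: (@real_lub _ _ (C * `|x|)).
    by exists (f 0), 0 => //=; split=> //; exact: cone_le_refl.
  move=> _ [y [y0 yx] <-]; apply: (le_trans (ler_norm _)).
  by apply: (le_trans (fC _)); apply: ler_wpM2l; [exact: ltW|exact: norm_mono].
have [|x x0|g dg gE] := @cone_extension (fun x => sup (A x)) C.
- move=> x y x0 y0; have [ux lx _] := AP x x0; have [uy ly _] := AP y y0.
  have [u l _] := AP _ (le_add_ge0 x0 y0); apply/le_anti/andP; split.
    apply: l => _ [z [z0 zxy] <-].
    have [z1 [z2 [-> z10 z1x z20 z2y]]] := riesz_decomposition x0 y0 z0 zxy.
    by rewrite dualD //; apply: lerD; [apply: ux; exists z1|apply: uy; exists z2].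
  rewrite -lerBrDr; apply: lx => _ [a [a0 ax] <-].
  rewrite lerBrDr addrC -lerBrDr; apply: ly => _ [b [b0 by_] <-].
  rewrite lerBrDr addrC -dualD //; apply: u; exists (a + b) => //=.
  by split; [exact: le_add_ge0|exact: le_add].
- have [u l _] := AP x x0; apply/andP; split.
    by rewrite -(dual0 df); apply: u; exists 0 => //=; split=> //; exact: cone_le_refl.
  apply: l => _ [y [y0 yx] <-]; apply: (le_trans (ler_norm _)).
  by apply: (le_trans (fC _)); apply: ler_wpM2l; [exact: ltW|exact: norm_mono].
exists g => //; split=> [x x0|x x0|x e x0 e0]; rewrite ?gE //.
- have [u _ _] := AP x x0.
  by rewrite -(dual0 df); apply: u; exists 0 => //=; split=> //; exact: cone_le_refl.
- have [u _ _] := AP x x0; apply: u; exists x => //=; split=> //; exact: cone_le_refl.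
- have [_ _ /(_ e e0) [_ [y [y0 yx] <-] h]] := AP x x0.
  by exists y; split=> //; move: h; lra.
Qed.

(** The join is [g] plus the positive part of [f - g]. *)
Lemma dual_join f g : dual f -> dual g -> exists2 k, dual k &
  [/\ dle f k, dle g k & forall h, dual h -> dle f h -> dle g h -> dle k h].
Proof.
move=> df dg; have [p dp [p0 pf pl]] := dual_pos_part (dual_sub df dg).
exists (fun x => p x + g x); first exact: dual_add.
split=> [x x0|x x0|h dh fh gh x x0].
- by have := pf x x0; lra.
- by have := p0 x x0; lra.
apply/ler_addgt0Pr => e e0; have [y [y0 yx py]] := pl x e x0 e0.
have : h y - g y <= h x - g x.
  by move/le_subr_ge0 : yx => /gh; rewrite !dualB //; lra.
by have := fh y y0; lra.
Qed.

(** With [k] the join of [f] and [a], the first piece [f + a - k] is their meet. *)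
Lemma dual_riesz f a b : dual f -> dual a -> dual b ->
  dle (fun _ => 0) f -> dle (fun _ => 0) a -> dle (fun _ => 0) b ->
  dle f (fun x => a x + b x) -> exists f1 f2, [/\ dual f1, dual f2,
    (dle (fun _ => 0) f1 /\ dle f1 a), (dle (fun _ => 0) f2 /\ dle f2 b) &
    forall x, f x = f1 x + f2 x].
Proof.
move=> df da db f0 a0 b0 fab; have [k dk [fk ak kl]] := dual_join df da.
have kfa : dle k (fun x => f x + a x).
  apply: kl => [|x x0|x x0]; first exact: dual_add.
    by have := a0 x x0; lra.
  by have := f0 x x0; lra.
have kab : dle k (fun x => a x + b x).
  by apply: kl => // [|x x0]; [exact: dual_add|have := b0 x x0; lra].
exists (fun x => f x + a x - k x), (fun x => k x - a x); split.
- by apply: dual_sub => //; exact: dual_add.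
- exact: dual_sub.
- by split=> x x0; [have := kfa x x0|have := fk x x0]; lra.
- by split=> x x0; [have := ak x x0|have := kab x x0]; lra.
- by move=> x; ring.
Qed.

(** The supremum is taken pointwise. Directedness makes it additive: members used at [x] and at [y]
    lie below a common member, used at [x + y]. *)
Lemma directed_sup (A : set (V -> R)) (C : R) : A !=set0 ->
  (forall g, A g -> dual g /\ dle (fun _ => 0) g) ->
  (forall g h, A g -> A h -> exists k, [/\ A k, dle g k & dle h k]) ->
  (forall g x, A g -> le 0 x -> g x <= C * `|x|) ->
  exists2 s, dual s & [/\ dle (fun _ => 0) s, forall g, A g -> dle g s &
    forall x m, le 0 x -> (forall g, A g -> g x <= m) -> s x <= m].
Proof.
move=> [g0 Ag0] Ap Adir AC.
pose B x := [set g x | g in A].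
have BP x : le 0 x -> [/\ forall a, B x a -> a <= sup (B x),
      forall m, (forall a, B x a -> a <= m) -> sup (B x) <= m &
      forall e, 0 < e -> exists2 a, B x a & sup (B x) - e < a].
  move=> x0; apply: (@real_lub _ _ (C * `|x|)); first by exists (g0 x), g0.
  by move=> _ [g Ag <-]; exact: AC.
have [|x x0|s ds sE] := @cone_extension (fun x => sup (B x)) C.
- move=> x y x0 y0; have [ux lx _] := BP x x0; have [uy ly _] := BP y y0.
  have [u l _] := BP _ (le_add_ge0 x0 y0); apply/le_anti/andP; split.
    apply: l => _ [g Ag <-]; have [dg _] := Ap g Ag.
    by rewrite dualD //; apply: lerD; [apply: ux; exists g|apply: uy; exists g].
  rewrite -lerBrDr; apply: lx => _ [g Ag <-].
  rewrite lerBrDr addrC -lerBrDr; apply: ly => _ [h Ah <-].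
  have [k [Ak gk hk]] := Adir g h Ag Ah; have [dk _] := Ap k Ak.
  rewrite lerBrDr addrC; apply: (@le_trans _ _ (k (x + y))).
    by rewrite dualD //; apply: lerD; [exact: gk|exact: hk].
  by apply: u; exists k.
- have [u l _] := BP x x0; apply/andP; split.
    have [_ /(_ x x0) h] := Ap _ Ag0; apply: (le_trans h); apply: u; by exists g0.
  by apply: l => _ [g Ag <-]; exact: AC.
exists s => //; split=> [x x0|g Ag x x0|x m x0 H]; rewrite sE //; have [u l _] := BP x x0.
- have [_ /(_ x x0) h] := Ap _ Ag0; apply: (le_trans h); apply: u; by exists g0.
- by apply: u; exists g.
- by apply: l => _ [g Ag <-]; exact: H.
Qed.

End BanachLattice.

(** * Positive functionals on a dual with order continuous norm *)

Lemma half_powers_le0 {R : realType} (x c : R) :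
  0 <= c -> (forall m : nat, x <= c * 2^-1 ^+ m) -> x <= 0.
Proof.
move=> c0 H; rewrite leNgt; apply/negP => x0.
have /andP [_] := Num.Theory.truncn_itv (divr_ge0 c0 (ltW x0)).
set n := Num.truncn _; rewrite ltNge => /negP; apply.
have := H n; rewrite exprVn ler_pdivlMr ?exprn_gt0 // => h.
rewrite ler_pdivlMr // mulrC; apply: le_trans h; apply: ler_wpM2l; first exact: ltW.
by rewrite -natrX ler_nat ltn_expl.
Qed.

Lemma half_powers_small {R : realType} (c e : R) :
  0 < e -> exists m : nat, c * 2^-1 ^+ m <= e.
Proof.
move=> e0; have [c0|c0] := leP c 0.
  by exists 0%N; rewrite expr0 mulr1 (le_trans c0) // ltW.
apply: contrapT => H; suff : e <= 0 by rewrite leNgt e0.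
apply: (half_powers_le0 (ltW c0)) => m; rewrite leNgt; apply/negP => h.
by apply: H; exists m; exact: ltW.
Qed.

Lemma dual_sum {R : realType} {V : normedModType R} (G : nat -> V -> R) (m M : nat) :
  (forall n, dual (G n)) -> dual (fun x => \sum_(m <= j < M) G j x).
Proof.
move=> dG; elim: M => [|M IH].
  by have := @dual_zero R V; congr dual; apply/funext => x; rewrite big_geq.
have [mM|Mm] := leqP m M.
  by have := dual_add IH (dG M); congr dual; apply/funext => x; rewrite big_nat_recr.
by have := @dual_zero R V; congr dual; apply/funext => x; rewrite big_geq.
Qed.

(** Only values on dual functionals are constrained. Boundedness refers to any Lipschitz constant
    [M] of [f], so that no supremum has to be computed to use it. *)
Definition positive_functional {R : realType} {V : normedModType R}
    (le : V -> V -> Prop) (u : (V -> R) -> R) : Prop :=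
  [/\ forall (a : R) f g, dual f -> dual g ->
        u (fun x => a * f x + g x) = a * u f + u g,
      forall f, dual f -> dual_le le (fun _ => 0) f -> 0 <= u f &
      exists2 C : R, 0 < C & forall f M, dual f -> 0 <= M ->
        (forall x, `|f x| <= M * `|x|) -> `|u f| <= C * M].

Section OrderContinuity.
Context {R : realType} {V : completeNormedModType R} {le : V -> V -> Prop}.
Hypothesis HV : banach_lattice le.
Implicit Types (x y z : V) (f g h : V -> R) (u v : (V -> R) -> R).
Local Notation dle := (dual_le le).
Local Notation pf := (positive_functional le).

Lemma pfD u f g : pf u -> dual f -> dual g -> u (fun x => f x + g x) = u f + u g.
Proof.
move=> [ul _ _] df dg; have := ul 1 f g df dg; rewrite mul1r => <-.
by congr u; apply/funext => x; rewrite mul1r.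
Qed.

Lemma pfB u f g : pf u -> dual f -> dual g -> u (fun x => f x - g x) = u f - u g.
Proof.
move=> [ul _ _] df dg; have := ul (-1) g f dg df; rewrite mulN1r addrC => <-.
by congr u; apply/funext => x; rewrite mulN1r addrC.
Qed.

Lemma pf_zero u : pf u -> u (fun _ => 0) = 0.
Proof.
move=> pu; have := pfB pu (@dual_zero R V) (@dual_zero R V); rewrite subrr => E.
by lra.
Qed.

Lemma pfZ u (a : R) f : pf u -> dual f -> u (fun x => a * f x) = a * u f.
Proof.
move=> pu df; have [ul _ _] := pu; have := ul a f _ df (@dual_zero R V).
rewrite pf_zero // addr0 => <-.
by congr u; apply/funext => x; rewrite addr0.
Qed.

Lemma pf_mono u f g : pf u -> dual f -> dual g -> dle f g -> u f <= u g.
Proof.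
move=> pu df dg fg; rewrite -subr_ge0 -pfB //; have [_ u0 _] := pu.
by apply: u0 => [|x x0]; [exact: dual_sub|rewrite subr_ge0; exact: fg].
Qed.

Hypothesis HOC : dual_order_continuous le.

(** The only direct use of order continuity: the norms of the net tend to zero, and [u] is
    bounded. *)
Lemma pf_decreasing_small (I : Type) (leI : I -> I -> Prop) (f : I -> V -> R) u :
  (forall i, leI i i) -> (forall i j k, leI i j -> leI j k -> leI i k) ->
  (forall i j, exists k, leI i k /\ leI j k) ->
  (forall i, dual (f i) /\ dle (fun _ => 0) (f i)) ->
  (forall i j, leI i j -> dle (f j) (f i)) ->
  (forall l, dual l -> (forall i, dle l (f i)) -> dle l (fun _ => 0)) ->
  pf u -> forall e, 0 < e -> exists i, u (f i) < e.
Proof.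
move=> Ir It Id fP fdec finf [_ _ [C C0 uC]] e e0.
have [||i /(_ i (Ir i)) fi] := HOC Ir It Id _ fdec _ (divr_gt0 e0 C0).
- by move=> i; have [] := fP i.
- split; first exact: dual_zero.
  split=> [_ [i _ <-]|l dl lf]; first by have [] := fP i.
  by apply: finf => // i; apply: lf; exists i.
exists i; have [di _] := fP i; have [fn _] := dual_norm_lub di.
apply: le_lt_trans (ler_norm _) _.
apply: le_lt_trans (uC _ _ di (dual_norm_ge0 di) fn) _.
by rewrite mulrC -ltr_pdivlMr.
Qed.

(* The part of [f] living off the band of [a]; it decreases to 0 as [a] grows. *)
Lemma dual_disjoint_part f a : dual f -> dle (fun _ => 0) f -> le 0 a ->
  exists h, [/\ dual h, dle (fun _ => 0) h, dle h f, h a = 0 &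
    forall g, dual g -> dle (fun _ => 0) g -> dle g f -> g a = 0 -> dle g h].
Proof.
move=> df f0 a0; have [C C0 fC] := dual_bounded df.
pose A g := [/\ dual g, dle (fun _ => 0) g, dle g f & g a = 0].
have [||||s ds [s0 sA sl]] := directed_sup HV (A := A) (C := C).
- by exists (fun _ => 0); split=> //; exact: dual_zero.
- by move=> g [].
- move=> g h [dg g0 gf ga] [dh h0 hf ha]; have [k dk [gk hk kl]] := dual_join HV dg dh.
  exists k; split=> //; split=> // [x x0||].
  + exact: le_trans (g0 x x0) (gk x x0).
  + exact: kl.
  + have := kl _ (dual_add dg dh); rewrite /dual_le => /(_ _ _ a a0); rewrite ga ha addr0 => H.
    apply/le_anti/andP; split; last exact: le_trans (g0 a a0) (gk a a0).
    by apply: H => x x0; [have := h0 x x0|have := g0 x x0]; lra.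
- move=> g x [dg g0 gf ga] x0; apply: le_trans (gf x x0) _.
  exact: le_trans (ler_norm _) (fC x).
exists s; split=> // [x x0||g dg g0 gf ga].
- by apply: sl => // g [_ _ gf _]; exact: gf.
- by apply/le_anti/andP; split; [apply: sl => // g [_ _ _ ->]|exact: s0].
- exact: sA.
Qed.

(** A Borel-Cantelli argument. If every [n] failed, with witness [G n], then [G n a <= u f / 2 ^ n].
    The truncated tails [s m], formed from [G j] with [j >= m], would decrease to a functional
    vanishing at [a], hence to zero, and [u (s m)] would fall below [e], although [G m <= s m] and
    [u (G m) > e]. *)
Lemma pf_bounded_on_band f a u e : dual f -> dle (fun _ => 0) f -> le 0 a ->
  (forall g, dual g -> dle (fun _ => 0) g -> dle g f -> g a = 0 -> dle g (fun _ => 0)) ->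
  pf u -> 0 < e -> exists n : nat, forall g, dual g -> dle (fun _ => 0) g ->
    dle g f -> u g <= 2 ^+ n * g a + e.
Proof.
move=> df f0 a0 fa pu e0; apply: contrapT => H.
have /choice [G GP] : forall n : nat, exists g, [/\ dual g, dle (fun _ => 0) g, dle g f &
    2 ^+ n * g a + e < u g].
  move=> n; apply: contrapT => Hn; apply: H; exists n => g dg g0 gf.
  by rewrite leNgt; apply/negP => h; apply: Hn; exists g.
have dG n : dual (G n) by have [] := GP n.
have G0 n x : le 0 x -> 0 <= G n x by have [_ + _ _] := GP n; exact.
pose c := u f.
have c0 : 0 <= c by have [_ + _] := pu; exact.
have Ga n : G n a <= c * 2^-1 ^+ n.
  have [_ _ Gf Ge] := GP n; rewrite exprVn ler_pdivlMr ?exprn_gt0 // mulrC.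
  by have := pf_mono pu (dG n) df Gf; rewrite -/c; lra.
have sumG m M x : le 0 x -> 0 <= \sum_(m <= j < M) G j x.
  by move=> x0; apply: sumr_ge0 => j _; exact: G0.
have sumGa m M : \sum_(m <= j < M) G j a <= 2 * c * 2^-1 ^+ m.
  (* The subtracted term makes the geometric bound inductive; the second alternative covers the
     empty range [M <= m]. *)
  suff : \sum_(m <= j < M) G j a <= 2 * c * (2^-1 ^+ m - 2^-1 ^+ M) \/
         \sum_(m <= j < M) G j a = 0.
    have p n : 0 <= c * 2^-1 ^+ n by rewrite mulr_ge0 // exprn_ge0.
    by have := p m; have := p M => ? ? [|->]; lra.
  elim: M => [|M IH]; first by right; rewrite big_geq.
  have [mM|Mm] := leqP m M; last by right; rewrite big_geq.
  left; rewrite big_nat_recr //= exprS; have := Ga M.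
  case: IH => [|->]; first by lra.
  have [->|mM'] := eqVneq m M; first by lra.
  have : c * 2^-1 ^+ M <= c * (2^-1 ^+ m * 2^-1).
    rewrite ler_wpM2l // -exprSr; apply: ler_wiXn2l => //; rewrite ?invr_ge0 ?invf_le1 ?ler1n //.
    by rewrite ltn_neqAle mM' mM.
  have : 0 <= c * 2^-1 ^+ m by rewrite mulr_ge0 // exprn_ge0.
  by lra.
have sumG_mono m m' M M' x : (m <= m')%N -> (M' <= M)%N -> le 0 x ->
    \sum_(m' <= j < M') G j x <= \sum_(m <= j < M) G j x.
  move=> mm MM x0; have [mM|Mm] := leqP m' M'; last by rewrite big_geq ?sumG // ltnW.
  rewrite [leRHS](big_cat_nat mm (leq_trans mM MM)) /=.
  rewrite [X in _ + X](big_cat_nat mM MM) /=.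
  by rewrite addrCA lerDl addr_ge0 ?sumG.
(* The partial sums need not be bounded; cutting them at [f] provides the bound under which their
   supremum exists. *)
pose A m g := [/\ dual g, dle (fun _ => 0) g, dle g f &
  exists M, dle g (fun x => \sum_(m <= j < M) G j x)].
have /choice [s sP] : forall m, exists s, [/\ dual s, dle (fun _ => 0) s,
    forall g, A m g -> dle g s &
    forall x b, le 0 x -> (forall g, A m g -> g x <= b) -> s x <= b].
  move=> m; have [C C0 fC] := dual_bounded df.
  have [||||s ds [s0 sA sl]] := directed_sup HV (A := A m) (C := C).
  - exists (fun _ => 0); split=> //; first exact: dual_zero.
    by exists 0%N => x x0; exact: sumG.
  - by move=> g [].
  - move=> g h [dg g0 gf [M gM]] [dh h0 hf [N hN]].
    have [k dk [gk hk kl]] := dual_join HV dg dh.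
    exists k; split=> //; split=> // [x x0||].
    + exact: le_trans (g0 x x0) (gk x x0).
    + exact: kl.
    + exists (maxn M N); apply: kl; first exact: dual_sum.
        by move=> x x0; apply: le_trans (gM x x0) _; apply: sumG_mono => //; exact: leq_maxl.
      by move=> x x0; apply: le_trans (hN x x0) _; apply: sumG_mono => //; exact: leq_maxr.
  - move=> g x [_ _ gf _] x0; apply: le_trans (gf x x0) _.
    exact: le_trans (ler_norm _) (fC x).
  by exists s.
have sf m : dle (s m) f.
  by move=> x x0; have [_ _ _ sl] := sP m; apply: sl => // g [_ _ gf _]; exact: gf.
have sa m : s m a <= 2 * c * 2^-1 ^+ m.
  have [_ _ _ sl] := sP m; apply: sl => // g [_ _ _ [M gM]].
  exact: le_trans (gM a a0) (sumGa m M).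
have [||||||m] := @pf_decreasing_small nat (fun i j => (i <= j)%N : Prop) s u _ _ _ _ _ _ pu e e0.
- by [].
- by move=> i j k; exact: leq_trans.
- by move=> i j; exists (maxn i j); rewrite leq_maxl leq_maxr.
- by move=> m; have [] := sP m.
- move=> m m' mm x x0; have [_ _ _ sl] := sP m'; apply: sl => // g [dg g0 gf [M gM]].
  have [_ _ sA _] := sP m; apply: sA => //; split=> //; exists M => z z0.
  by apply: le_trans (gM z z0) _; exact: sumG_mono.
(* A lower bound [l] need not be positive, so its positive part [p] is shown to vanish at [a]. *)
- move=> l dl ls; have [p dp [lp p0 pl]] := dual_join HV dl (@dual_zero R V).
  have ps m : dle p (s m) by have [ds s0 _ _] := sP m; exact: pl.
  have pf0 : dle p f by move=> x x0; exact: le_trans (ps 0%N x x0) (sf 0%N x x0).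
  have pa : p a = 0.
    apply/le_anti/andP; split; last exact: p0.
    apply: (@half_powers_le0 _ _ (2 * c)) => [|m]; first by lra.
    exact: le_trans (ps m a a0) (sa m).
  by move=> x x0; apply: le_trans (lp x x0) _; exact: fa.
have [ds _ sA _] := sP m; have [_ _ Gf Ge] := GP m.
have : dle (G m) (s m).
  apply: sA; split=> //; first by move=> x; exact: G0.
  by exists m.+1 => x x0; rewrite big_nat1.
move=> /(pf_mono pu (dG m) ds); have : 0 <= 2 ^+ m * G m a by rewrite mulr_ge0 ?exprn_ge0 ?G0.
by lra.
Qed.

(** The parts of [f] off the bands of positive [a] decrease to zero, since the part attached to [x]
    vanishes at [x]. Hence [u] is small on one of them, and on the rest of [f] a multiple of [a]
    dominates [u] up to [e / 2]. *)
Lemma pf_almost_dominated u f e : pf u -> dual f -> dle (fun _ => 0) f -> 0 < e ->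
  exists2 b, le 0 b & forall g, dual g -> dle (fun _ => 0) g -> dle g f -> u g <= g b + e.
Proof.
move=> pu df f0 e0.
have /choice [h hP] : forall a : {a | le 0 a}, exists h,
    [/\ dual h, dle (fun _ => 0) h, dle h f, h (sval a) = 0 &
    forall g, dual g -> dle (fun _ => 0) g -> dle g f -> g (sval a) = 0 -> dle g h].
  by move=> [a a0]; exact: dual_disjoint_part.
have e2 : 0 < e / 2 by lra.
have [||||||[a a0]] := @pf_decreasing_small {a | le 0 a} (fun a b => le (sval a) (sval b)) h u
   _ _ _ _ _ _ pu _ e2.
- by move=> a; exact: (cone_le_refl HV).
- by move=> a b c; exact: (cone_le_trans HV).
- move=> [a a0] [b b0]; exists (exist _ (a + b) (le_add_ge0 HV a0 b0)) => /=.
  by split; apply/(le_subr_ge0 HV); rewrite ?addrK // addrAC subrr add0r.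
- by move=> a; have [] := hP a.
- move=> a b ab; have [db b0 bf hb _] := hP b; have [_ _ _ _] := hP a; apply=> //.
  have a0 := svalP a; apply/le_anti/andP; split; last exact: b0.
  by rewrite -hb; exact: (dual_ge0_mono HV).
- move=> l dl lh x x0; have := lh (exist _ x x0) x x0.
  by have [_ _ _ /= -> _] := hP (exist _ x x0).
have [] := hP (exist _ a a0); rewrite /=; set k := h _ => dk k0 kf ka kl uk.
have dfk := dual_sub df dk.
have fk0 : dle (fun _ => 0) (fun x => f x - k x).
  by move=> x x0; rewrite subr_ge0; exact: kf.
(* A positive part of [f - k] vanishing at [a] could be added to [k], so maximality of [k] makes it
   zero. *)
have [|n nP] := pf_bounded_on_band dfk fk0 a0 _ pu e2.
  move=> g dg g0 gfk ga x x0; have := kl _ (dual_add dg dk).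
  rewrite /dual_le ga ka addr0 => H; have : g x + k x <= k x; last by lra.
  apply: H => // z z0; first by have := g0 z z0; have := k0 z z0; lra.
  by have := gfk z z0; lra.
have n0 : 0 <= 2 ^+ n :> R by rewrite exprn_ge0.
exists (2 ^+ n *: a); first exact: (le_scale HV).
move=> g dg g0 gf; have [|g1 [g2 [d1 d2 [g10 g1k] [g20 g2f] gE]]] := dual_riesz HV dg dk dfk g0 k0 fk0.
  by move=> x x0; have := gf x x0; lra.
rewrite dualZ // gE; have -> : u g = u g1 + u g2.
  by rewrite -(pfD pu d1 d2); congr u; apply/funext.
have := pf_mono pu d1 dk g1k; have := nP g2 d2 g20 g2f.
by have := mulr_ge0 n0 (g10 a a0); lra.
Qed.

End OrderContinuity.

(** * Symmetry of the Arens extension of positive bilinear forms *)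

Section ArensSymmetry.
Context {R : realType} {V : completeNormedModType R} {le : V -> V -> Prop}.
Hypothesis HV : banach_lattice le.
Hypothesis HOC : dual_order_continuous le.
Implicit Types (x y z : V) (f g h : V -> R) (u v : (V -> R) -> R).
Local Notation dle := (dual_le le).
Local Notation pf := (positive_functional le).

(** [g] stands in for the component of [f] on which [u] exceeds evaluation at [c]; the supremum need
    not be attained, whence [d]. *)
Lemma near_maximizer u f c d : pf u -> dual f -> dle (fun _ => 0) f -> le 0 c -> 0 < d ->
  exists g, [/\ dual g, dle (fun _ => 0) g, dle g f &
    forall h, dual h -> dle (fun _ => 0) h -> dle h f -> u h - h c <= u g - g c + d].
Proof.
move=> pu df f0 c0 d0.
pose A := [set u h - h c | h in [set h | [/\ dual h, dle (fun _ => 0) h & dle h f]]].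
have [||ub _ /(_ d d0) [_ [g [dg g0 gf] <-] gd]] := @real_lub R A (u f).
- by exists (u (fun _ => 0) - 0); exists (fun _ => 0) => //; split=> //; exact: dual_zero.
- move=> _ [h [dh h0 hf] <-]; have := pf_mono pu dh df hf; have := h0 c c0; lra.
exists g; split=> // h dh h0 hf; have : u h - h c <= sup A by apply: ub; exists h.
lra.
Qed.

(* With [g] a near-maximizer of [u - J c] on [0, f], write [f = p + q + r] with
   [p], [q] the parts of [2 g - f] and [r] twice the meet of [g] and [f - g]: on [p]
   the functional [u - J c] is nearly positive, on [q] nearly negative, on [r] nearly
   zero, and some [y] in [0, b] is close to [b] on [p] and to [0] on [q]. *)
Lemma approximation_step u f b x (k : nat) e d : pf u -> dual f -> dle (fun _ => 0) f ->
  le 0 b -> le 0 x -> 0 < d ->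
  (forall h, dual h -> dle (fun _ => 0) h -> dle h f ->
     - d <= u h - h x <= 2^-1 ^+ k * h b + e + d) ->
  exists2 x', le 0 x' & forall h, dual h -> dle (fun _ => 0) h -> dle h f ->
     - (5 * d) <= u h - h x' <= 2^-1 ^+ k.+1 * h b + e + 5 * d.
Proof.
move=> pu df f0 b0 x0 d0 H; pose c : R := 2^-1 ^+ k.+1.
have cE : 2^-1 ^+ k = 2 * c by rewrite /c exprS; field.
have c0 : 0 <= c by rewrite /c exprn_ge0.
have c1 : c <= 1 by rewrite /c exprn_ile1 // invf_le1 // ler1n.
have d20 : 0 < d / 2 by lra.
have xcb0 : le 0 (x + c *: b) by apply: (le_add_ge0 HV) => //; exact: (le_scale HV).
(* [x + c *: b] is the midpoint of [x] and [x + 2^-1 ^+ k *: b], between which [H] places [u] up to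
   errors. *)
have [g [dg g0 gf gmax]] := near_maximizer pu df f0 xcb0 d20.
have dgg := dual_add dg dg.
have [p dp [p0 tp pnear]] := dual_pos_part HV (dual_sub dgg df).
have plub h : dual h -> dle (fun _ => 0) h -> dle (fun z => g z + g z - f z) h -> dle p h.
  move=> dh h0 fh z z0; apply/ler_addgt0Pr => t t0; have [y [y0 yz]] := pnear z t z0 t0.
  have := fh y y0; have := dual_ge0_mono HV dh h0 yz; lra.
have pg : dle p g by apply: plub => // z z0; have := gf z z0; lra.
pose q z := p z - (g z + g z - f z); pose r z := (g z - p z) + (g z - p z).
have dq : dual q by apply: dual_sub => //; exact: dual_sub.
have dgp := dual_sub dg dp.
have dr : dual r by exact: dual_add.
have q0 : dle (fun _ => 0) q by move=> z z0; rewrite /q; have := tp z z0; lra.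
have r0 : dle (fun _ => 0) r by move=> z z0; rewrite /r; have := pg z z0; lra.
(* Since [p - q = 2 g - f], this choice gives [p (b - y) + q y <= d], which controls both terms at
   once. *)
have [y [y0 yb py]] := pnear b d b0 d0.
have small h1 : dual h1 -> dle (fun _ => 0) h1 -> dle h1 g -> - (d / 2) <= u h1 - h1 (x + c *: b).
  move=> dh h0 hg; have := gmax _ (dual_sub dg dh); rewrite (pfB pu) // => A.
  have : u g - u h1 - (g (x + c *: b) - h1 (x + c *: b)) <= u g - g (x + c *: b) + d / 2.
    by apply: A => z z0; have := h0 z z0; have := hg z z0; have := gf z z0; lra.
  lra.
have large h1 : dual h1 -> dle (fun _ => 0) h1 -> dle h1 (fun z => f z - g z) ->
    u h1 - h1 (x + c *: b) <= d / 2.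
  move=> dh h0 hg; have := gmax _ (dual_add dg dh); rewrite (pfD pu) // => A.
  have : u g + u h1 - (g (x + c *: b) + h1 (x + c *: b)) <= u g - g (x + c *: b) + d / 2.
    by apply: A => z z0; have := h0 z z0; have := hg z z0; have := g0 z z0; lra.
  lra.
exists (x + c *: y); first by apply: (le_add_ge0 HV) => //; exact: (le_scale HV).
move=> h dh h0 hf.
have [|hp [h' [dhp dh' [hp0 hpp] [h'0 h'q] hE]]] :=
  dual_riesz HV dh dp (dual_add dq dr) h0 p0 (fun z hz => addr_ge0 (q0 z hz) (r0 z hz)).
  by move=> z z0; have := hf z z0; rewrite /q /r; lra.
have [hq [hr [dhq dhr [hq0 hqq] [hr0 hrr] h'E]]] := dual_riesz HV dh' dq dr h'0 q0 r0 h'q.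
have uE : u h = u hp + u hq + u hr.
  rewrite -(pfD pu dhp dhq) -(pfD pu (dual_add dhp dhq) dhr); congr u.
  by apply/funext => z; rewrite hE h'E addrA.
have hz z : h z = hp z + hq z + hr z by rewrite hE h'E addrA.
have hpg : dle hp g by move=> z z0; exact: le_trans (hpp z z0) (pg z z0).
have hqg : dle hq (fun z => f z - g z).
  by move=> z z0; have := hqq z z0; have := pg z z0; rewrite /q; lra.
have hqf : dle hq f by move=> z z0; have := hqg z z0; have := g0 z z0; lra.
have hpf : dle hp f by move=> z z0; have := hpg z z0; have := gf z z0; lra.
have dhr2 := dual_scale 2^-1 dhr.
have hr2 : dle (fun z => 2^-1 * hr z) (fun z => g z - p z).
  by move=> z z0; have := hrr z z0; rewrite /r; lra.
have hr20 : dle (fun _ => 0) (fun z => 2^-1 * hr z).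
  by move=> z z0; have := hr0 z z0; lra.
have := small hp dhp hp0 hpg.
have := large hq dhq hq0 hqg.
have : - (d / 2) <= u (fun z => 2^-1 * hr z) - 2^-1 * hr (x + c *: b).
  by apply: small => // z z0; have := hr2 z z0; have := p0 z z0; lra.
have : u (fun z => 2^-1 * hr z) - 2^-1 * hr (x + c *: b) <= d / 2.
  by apply: large => // z z0; have := hr2 z z0; have := tp z z0; lra.
(* The old upper bound is used on [hp] alone, so [e] is counted once and does not grow with [k]. The
   remaining errors stay below [5 * d]. *)
have /andP [_ Hp] := H hp dhp hp0 hpf.
have /andP [Hq _] := H hq dhq hq0 hqf.
have lin w z : dual w -> w (x + c *: z) = w x + c * w z by move=> dw; rewrite dualD // dualZ.
move: Hp Hq; rewrite (pfZ _ pu dhr) (lin hp b dhp) (lin hq b dhq) (lin hr b dhr) (lin h y dh).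
rewrite uE (hz x) (hz y) (hz b) cE.
have mono w : dual w -> dle (fun _ => 0) w -> w y <= w b by move=> dw w0; exact: (dual_ge0_mono HV).
have pby : hp b - hp y <= p b - p y.
  have := mono _ (dual_sub dp dhp); rewrite -subr_ge0 => A.
  have := A _; rewrite /dual_le => /(_ _)B; have : 0 <= p b - hp b - (p y - hp y).
    by apply: B => z z0; rewrite subr_ge0; exact: hpp.
  lra.
have a1 : 0 <= c * (hp b - hp y) by rewrite mulr_ge0 // subr_ge0 mono.
have a2 : c * (hp b - hp y) <= d.
  have h1 : hp b - hp y <= d by have := q0 y y0; rewrite /q; lra.
  apply: le_trans h1; rewrite ler_piMl // subr_ge0; exact: mono.
have a3 : 0 <= c * hq y by rewrite mulr_ge0 // hq0.
have a4 : c * hq y <= d.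
  have h1 : hq y <= d.
    have := hqq y y0; have := mono _ dp p0; rewrite /q; lra.
  by apply: le_trans h1; rewrite ler_piMl // hq0.
have a5 : 0 <= c * (hq b - hq y) by rewrite mulr_ge0 // subr_ge0 mono.
have a6 : 0 <= c * (hr b - hr y) by rewrite mulr_ge0 // subr_ge0 mono.
have a7 : 0 <= c * hr y by rewrite mulr_ge0 // hr0.
rewrite -/c => *; apply/andP; split; lra.
Qed.

(** The induction is over all [d], so each step can start from [d / 5] and its factor five never
    accumulates. Three errors [e / 4] remain: domination by [b], the final [d], and
    [2^-1 ^+ k * f b] for [k] large. *)
Lemma pf_approximation u f e : pf u -> dual f -> dle (fun _ => 0) f -> 0 < e ->
  exists2 x, le 0 x & forall h, dual h -> dle (fun _ => 0) h -> dle h f ->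
    `|u h - h x| <= e.
Proof.
move=> pu df f0 e0; have e4 : 0 < e / 4 by lra.
have [b b0 ub] := pf_almost_dominated HV HOC pu df f0 e4.
have step (k : nat) : forall d, 0 < d -> exists2 x, le 0 x &
    forall h, dual h -> dle (fun _ => 0) h -> dle h f ->
     - d <= u h - h x <= 2^-1 ^+ k * h b + e / 4 + d.
  elim: k => [|k IH] d d0.
    exists 0; first exact: (cone_le_refl HV).
    move=> h dh h0 hf; rewrite dual0 // expr0 subr0 mul1r.
    have [_ u0 _] := pu; have := u0 h dh h0; have := ub h dh h0 hf => ? ?.
    by apply/andP; split; lra.
  have d5 : 0 < d / 5 by lra.
  have [x x0 Hx] := IH _ d5; have [x' x'0 Hx'] := approximation_step pu df f0 b0 x0 d5 Hx.
  exists x' => // h dh h0 hf; have := Hx' h dh h0 hf.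
  by rewrite (_ : 5 * (d / 5) = d) //; field.
have [k kP] := half_powers_small (f b) e4.
have [x x0 Hx] := step k _ e4; exists x => // h dh h0 hf.
have /andP [l r] := Hx h dh h0 hf.
have : 2^-1 ^+ k * h b <= 2^-1 ^+ k * f b by rewrite ler_wpM2l ?exprn_ge0 //; exact: hf.
by move: kP; rewrite mulrC ler_norml => *; apply/andP; split; lra.
Qed.

(* The tail [(v - J a)^+ (B x)], as a functional of [x], decreases to zero with [a]. *)
Lemma bilinear_tail (B : V -> V -> R) (C : R) u v e :
  (forall x, dual (B x)) -> (forall y, dual (B^~ y)) ->
  (forall x y, le 0 x -> le 0 y -> 0 <= B x y) ->
  0 <= C -> (forall x y, `|B x y| <= C * `|x| * `|y|) ->
  pf u -> pf v -> 0 < e ->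
  exists a t, [/\ le 0 a, dual t, dle (fun _ => 0) t, u t < e &
    (forall x, le 0 x -> t x <= v (B x)) /\
    forall x h, le 0 x -> dual h -> dle (fun _ => 0) h -> dle h (B x) ->
      v h - h a <= t x].
Proof.
move=> dB dB' B0 C0 BC pu pv e0.
have [_ v0 [D D0 vD]] := pv.
pose S a x := [set v h - h a | h in [set h | [/\ dual h, dle (fun _ => 0) h & dle h (B x)]]].
have Bx0 x : le 0 x -> dle (fun _ => 0) (B x) by move=> x0 y y0; exact: B0.
have hle a x h : le 0 a -> dual h -> dle (fun _ => 0) h -> dle h (B x) -> v h - h a <= v (B x).
  by move=> a0 dh h0 hB; have := pf_mono pv dh (dB x) hB; have := h0 a a0; lra.
have SP a x : le 0 a -> le 0 x -> [/\ forall s, S a x s -> s <= sup (S a x),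
      forall m, (forall s, S a x s -> s <= m) -> sup (S a x) <= m &
      forall e, 0 < e -> exists2 s, S a x s & sup (S a x) - e < s].
  move=> a0 x0; apply: (@real_lub R _ (v (B x))).
    exists (v (fun _ => 0) - 0), (fun _ => 0) => //.
    by split=> //; [exact: dual_zero|exact: Bx0].
  by move=> _ [h [dh h0 hB] <-]; exact: hle.
have BD x y : B (x + y) = fun z => B x z + B y z.
  by apply/funext => z; rewrite (dualD _ _ (dB' z)).
have /choice [t tP] : forall a : {a | le 0 a}, exists t, dual t /\
    forall x, le 0 x -> t x = sup (S (sval a) x).
  (* Additivity in [x] comes from decomposing [h <= B x + B y] in the dual; the constant combines
     [D] for [v] with [C] for [B]. *)
  move=> [a a0]; have [|x x0|t dt tE] := cone_extension HV (p := fun x => sup (S a x)) (C := D * C).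
  - move=> x y x0 y0; have [ux lx _] := SP a x a0 x0; have [uy ly _] := SP a y a0 y0.
    have [ul l _] := SP a _ a0 (le_add_ge0 HV x0 y0); apply/le_anti/andP; split.
      apply: l => _ [h [dh h0 hB] <-].
      have [|h1 [h2 [d1 d2 [h10 h1B] [h20 h2B] hE]]] :=
        dual_riesz HV dh (dB x) (dB y) h0 (Bx0 x x0) (Bx0 y y0).
        by rewrite -BD.
      have -> : v h = v h1 + v h2 by rewrite -(pfD pv d1 d2); congr v; apply/funext.
      have : v h1 - h1 a <= sup (S a x) by apply: ux; exists h1.
      have : v h2 - h2 a <= sup (S a y) by apply: uy; exists h2.
      by rewrite hE; lra.
    rewrite -lerBrDr; apply: lx => _ [h1 [d1 h10 h1B] <-].
    rewrite lerBrDr addrC -lerBrDr; apply: ly => _ [h2 [d2 h20 h2B] <-].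
    rewrite lerBrDr; apply: le_trans (ul (v (fun z => h1 z + h2 z) - (h1 a + h2 a)) _).
      by rewrite (pfD pv) //; lra.
    exists (fun z => h1 z + h2 z) => //; split; first exact: dual_add.
      by move=> z z0; have := h10 z z0; have := h20 z z0; lra.
    by rewrite BD => z z0; have := h1B z z0; have := h2B z z0; lra.
  - have [ux lx _] := SP a x a0 x0; apply/andP; split.
      apply: ux; exists (fun _ => 0); last by rewrite (pf_zero pv) subr0.
      by split=> //; [exact: dual_zero|exact: Bx0].
    apply: lx => _ [h [dh h0 hB] <-]; apply: le_trans (hle a x h a0 dh h0 hB) _.
    apply: le_trans (ler_norm _) _; rewrite -mulrA; apply: vD => //.
    by rewrite mulr_ge0.
  by exists t.
have t0 a : dle (fun _ => 0) (t a).
  move=> x x0; have [_ ->] // := tP a; have [ux _ _] := SP _ x (svalP a) x0.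
  apply: ux; exists (fun _ => 0); last by rewrite (pf_zero pv) subr0.
  by split=> //; [exact: dual_zero|exact: Bx0].
have [||||||[a a0] ta] := @pf_decreasing_small R V le HOC {a | le 0 a}
  (fun a b => le (sval a) (sval b)) t u _ _ _ _ _ _ pu e e0.
- by move=> a; exact: (cone_le_refl HV).
- by move=> a b c; exact: (cone_le_trans HV).
- move=> [a a0] [b b0]; exists (exist _ (a + b) (le_add_ge0 HV a0 b0)) => /=.
  by split; apply/(le_subr_ge0 HV); rewrite ?addrK // addrAC subrr add0r.
- by move=> a; split; [have [] := tP a|exact: t0].
- move=> [a a0] [b b0] /= ab x x0; have [_ ->] // := tP (exist _ b b0).
  have [_ ->] // := tP (exist _ a a0); rewrite /=.
  have [ua _ _] := SP a x a0 x0; have [_ lb _] := SP b x b0 x0.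
  apply: lb => _ [h [dh h0 hB] <-]; apply: le_trans (ua (v h - h a) _); last by exists h.
  by have := dual_ge0_mono HV dh h0 ab; lra.
(* At a fixed [x], evaluation at a suitable [a] dominates [v] on [[0, B x]] up to [d], so the tail
   at [x] is at most [d]. *)
- move=> l dl lt x x0; apply/ler_addgt0Pr => d d0; rewrite add0r.
  have [a a0 Ha] := pf_almost_dominated HV HOC pv (dB x) (Bx0 x x0) d0.
  apply: le_trans (lt (exist _ a a0) x x0) _; have [_ ->] // := tP (exist _ a a0).
  have [_ la _] := SP a x a0 x0; apply: la => _ [h [dh h0 hB] <-].
  by have := Ha h dh h0 hB; lra.
exists a, (t (exist _ a a0)); split=> //; first by have [] := tP (exist _ a a0).
have [_ tE] := tP (exist _ a a0); split=> [x x0|x h x0 dh h0 hB]; rewrite tE //=.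
  have [_ l _] := SP a x a0 x0; by apply: l => _ [h [dh h0 hB] <-]; exact: hle.
by have [ux _ _] := SP a x a0 x0; apply: ux; exists h.
Qed.

Section Bilinear.
Variables (B : V -> V -> R) (C : R).
Hypothesis dB : forall x, dual (B x).
Hypothesis dB' : forall y, dual (B^~ y).
Hypothesis B0 : forall x y, le 0 x -> le 0 y -> 0 <= B x y.
Hypothesis C0 : 0 <= C.
Hypothesis BC : forall x y, `|B x y| <= C * `|x| * `|y|.

Lemma pf_partial_dual u : pf u -> dual (fun y => u (B^~ y)).
Proof.
move=> pu; have [ul _ [D D0 uD]] := pu.
apply: (@dual_intro _ _ _ (D * C)) => [a y z|y].
  rewrite -ul //; congr u; apply/funext => x; exact: dualP.
rewrite -mulrA; apply: uD => // [|x]; first by rewrite mulr_ge0.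
by rewrite mulrAC; exact: BC.
Qed.

Lemma pf_partial_ge0 u : pf u -> dle (fun _ => 0) (fun y => u (B^~ y)).
Proof. by move=> [_ u0 _] y y0; apply: u0 => // x x0; exact: B0. Qed.

End Bilinear.

(** The interval [[0, fv + B^~ a]] contains [fv], the tail [t], and every [B^~ y] with
    [0 <= y <= a], so one [x] approximates [u] on all of them. With [w] the positive part of
    [B x - gu], the difference [v (B x) - v gu] is at most [v w], hence at most [w a + t x]. *)
Lemma arens_exchange_le (B : V -> V -> R) (C : R) u v :
  (forall x, dual (B x)) -> (forall y, dual (B^~ y)) ->
  (forall x y, le 0 x -> le 0 y -> 0 <= B x y) ->
  0 <= C -> (forall x y, `|B x y| <= C * `|x| * `|y|) ->
  pf u -> pf v ->
  u (fun x => v (B x)) <= v (fun y => u (B^~ y)).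
Proof.
move=> dB dB' B0 C0 BC pu pv; apply/ler_addgt0Pr => e' e'0.
(* Five errors: one from [u fv], two from [t x], two from [w a]. *)
have e0 : 0 < e' / 5 by lra.
set e := e' / 5 in e0; have e'E : e' = 5 * e by rewrite /e; field.
have [a [t [a0 dt t0 ut [tB tmax]]]] := bilinear_tail dB dB' B0 C0 BC pu pv e0.
have BC' x y : `|B y x| <= C * `|x| * `|y| by rewrite mulrAC; exact: BC.
pose fv x := v (B x); pose gu y := u (B^~ y).
have dfv : dual fv by apply: (pf_partial_dual (B := fun x y => B y x) dB' dB C0 BC' pv).
have fv0 : dle (fun _ => 0) fv by apply: (pf_partial_ge0 (B := fun x y => B y x)) => // x y ? ?; exact: B0.
have dgu : dual gu := pf_partial_dual dB dB' C0 BC pu.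
have gu0 : dle (fun _ => 0) gu := pf_partial_ge0 dB' B0 pu.
have m0 : dle (fun _ => 0) (B^~ a) by move=> x x0; exact: B0.
have [|x x0 ux] := pf_approximation pu (dual_add dfv (dB' a)) _ e0.
  by move=> z z0; have := fv0 z z0; have := m0 z z0; lra.
have := ux fv dfv fv0; rewrite ler_norml => H1.
have /andP [_ h1] : - e <= u fv - fv x <= e.
  by apply: H1 => z z0; have := m0 z z0; lra.
have := ux t dt t0; rewrite ler_norml => H2.
have /andP [h2 _] : - e <= u t - t x <= e.
  by apply: H2 => z z0; have := m0 z z0; have := tB z z0; rewrite /fv; lra.
have dd := dual_sub (dB x) dgu.
have [w dw [w0 dw' wnear]] := dual_pos_part HV dd.
have wB : dle w (B x).
  move=> y y0; apply/ler_addgt0Pr => d d0; have [z [z0 zy]] := wnear y d y0 d0.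
  have := gu0 z z0; have := dual_ge0_mono HV (dB x) (fun z hz => B0 x z x0 hz) zy; lra.
have [y [y0 ya wy]] := wnear a e a0 e0.
have := ux (B^~ y) (dB' y) (fun z hz => B0 z y hz y0); rewrite ler_norml => H3.
have /andP [h3 _] : - e <= u (B^~ y) - B x y <= e.
  apply: H3 => z z0; have := fv0 z z0.
  by have := dual_ge0_mono HV (dB z) (fun s hs => B0 z s z0 hs) ya; lra.
have := tmax x w x0 dw w0 wB.
have : v (B x) - v gu <= v w by rewrite -(pfB pv) //; exact: (pf_mono pv).
rewrite -/fv -/gu e'E; move: wy h1 h2 h3 ut; rewrite /gu /fv -/e; lra.
Qed.

Lemma arens_exchange (B : V -> V -> R) (C : R) u v :
  (forall x, dual (B x)) -> (forall y, dual (B^~ y)) ->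
  (forall x y, le 0 x -> le 0 y -> 0 <= B x y) ->
  0 <= C -> (forall x y, `|B x y| <= C * `|x| * `|y|) ->
  pf u -> pf v ->
  u (fun x => v (B x)) = v (fun y => u (B^~ y)).
Proof.
move=> dB dB' B0 C0 BC pu pv; apply/le_anti/andP; split; first exact: (arens_exchange_le dB dB' B0 C0 BC pu pv).
have B0' x y : le 0 x -> le 0 y -> 0 <= B y x by move=> x0 y0; exact: B0.
have BC' x y : `|B y x| <= C * `|x| * `|y| by rewrite mulrAC; exact: BC.
exact: (arens_exchange_le (B := fun x y => B y x) dB' dB B0' C0 BC' pv pu).
Qed.

End ArensSymmetry.

(** * Multilinear maps and polarization *)

Section Multilinear.
Context {R : realType} {V : lmodType R}.

(** Multilinearity by recursion on the head of the sequence, the recursion that [arens] follows. *)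
Fixpoint mlin {W : lmodType R} (n : nat) (T : seq V -> W) : Prop :=
  if n isn't m.+1 then True else
  (forall s, size s = m -> forall (a : R) x y,
     T (a *: x + y :: s) = a *: T (x :: s) + T (y :: s)) /\
  forall x, mlin m (fun s => T (x :: s)).

Lemma mlinP {W : lmodType R} (n : nat) (T : seq V -> W) :
  (forall s, size s = n -> forall i, (i < n)%N -> forall (a : R) x y,
     T (set_nth 0 s i (a *: x + y)) =
       a *: T (set_nth 0 s i x) + T (set_nth 0 s i y)) <-> mlin n T.
Proof.
elim: n T => [|n IH] T /=; first by split.
split=> [H|[H1 H2] [|x s] //= [ss] [|i] ilt a y z /=]; last 2 first.
- exact: H1.
- by have /IH := H2 x; apply.
split=> [s ss a x y|x]; first by apply: (H (0 :: s) _ 0%N) => //=; rewrite ss.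
by apply/IH => s ss i ilt a y z; apply: (H (x :: s) _ i.+1) => //=; rewrite ss.
Qed.

Lemma mlin_ext {W : lmodType R} n (T T' : seq V -> W) :
  (forall s, size s = n -> T s = T' s) -> mlin n T -> mlin n T'.
Proof.
elim: n T T' => [//|n IH] T T' TT' /= [H1 H2]; split=> [s ss a x y|x].
  by rewrite -!TT' /= ?ss //; exact: H1.
by apply: IH (H2 x) => s ss; apply: TT'; rewrite /= ss.
Qed.

Lemma mlin_comp {W W' : lmodType R} n (L : W -> W') (T : seq V -> W) :
  (forall (a : R) x y, L (a *: x + y) = a *: L x + L y) ->
  mlin n T -> mlin n (fun s => L (T s)).
Proof.
move=> LL; elim: n T => [//|n IH] T /= [H1 H2]; split=> [s ss a x y|x]; last exact: IH.
by rewrite H1.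
Qed.

Lemma mlin_comb {W : lmodType R} n (a : R) (T T' : seq V -> W) :
  mlin n T -> mlin n T' -> mlin n (fun s => a *: T s + T' s).
Proof.
elim: n T T' => [//|n IH] T T' /= [H1 H2] [H1' H2']; split=> [s ss b x y|x].
  by rewrite H1 // H1' // !scalerDr !scalerA [b * a]mulrC addrACA.
exact: IH.
Qed.

Lemma mlin_sum {W : lmodType R} {I : Type} n (r : seq I) (T : I -> seq V -> W) :
  (forall i, mlin n (T i)) -> mlin n (fun s => \sum_(i <- r) T i s).
Proof.
move=> HT; elim: r => [|i r IH].
  apply: (@mlin_ext _ _ (fun _ => 0)) => [s _|]; first by rewrite big_nil.
  by elim: n {HT} => [//|n IH]; split=> // *; rewrite scaler0 addr0.
apply: (@mlin_ext _ _ (fun s => 1 *: T i s + \sum_(j <- r) T j s)) => [s _|].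
  by rewrite big_cons scale1r.
exact: mlin_comb.
Qed.

(** Setting entry [i] before permuting is setting entry [sigma^-1 i] afterwards; this carries
    multilinearity through a permutation of the variables. *)
Lemma perm_seq_set_nth n (s : seq V) (sigma : {perm 'I_n}) (i : nat) (ilt : (i < n)%N) z : size s = n ->
  [seq (set_nth 0 s i z)`_(sigma k) | k : 'I_n] =
  set_nth 0 [seq s`_(sigma k) | k : 'I_n] ((sigma^-1)%g (Ordinal ilt)) z.
Proof.
move=> ss; set j := (sigma^-1)%g _.
have szE (F : 'I_n -> V) : size [seq F k | k : 'I_n] = n by rewrite size_image card_ord.
apply: (@eq_from_nth _ 0).
  by rewrite size_set_nth !szE; apply/esym/maxn_idPr.
move=> k; rewrite szE => klt; rewrite nth_set_nth /=.
have nthE (F : 'I_n -> V) : [seq F k | k : 'I_n]`_k = F (Ordinal klt).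
  rewrite /image_mem (nth_map (Ordinal klt)) ?size_enum_ord //; congr F.
  by apply: val_inj; rewrite /= nth_enum_ord.
rewrite !nthE nth_set_nth /=.
have -> : (sigma (Ordinal klt) == i :> nat) = (k == j :> nat).
  rewrite -[i]/(val (Ordinal ilt)) -[k]/(val (Ordinal klt)) !(inj_eq val_inj).
  by rewrite -(inj_eq (@perm_inj _ sigma^-1)) permK.
by [].
Qed.

Lemma mlin_perm {W : lmodType R} n (T : seq V -> W) (sigma : {perm 'I_n}) :
  mlin n T -> mlin n (fun s => T [seq s`_(sigma k) | k : 'I_n]).
Proof.
move=> /mlinP HT; apply/mlinP => s ss i ilt a x y.
by rewrite !(perm_seq_set_nth sigma ilt) //; apply: HT; rewrite ?size_image ?card_ord.
Qed.

Lemma perm_seq_perm n (s : seq V) (sigma : {perm 'I_n}) : size s = n ->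
  perm_eq [seq s`_(sigma k) | k : 'I_n] s.
Proof.
move=> ss; have /eqP ss' := ss.
rewrite -[s in X in perm_eq _ X]/(tval (Tuple ss')).
apply/tuple_permP; exists sigma; apply: eq_image => // k.
by rewrite (tnth_nth 0).
Qed.

Lemma perm_eq_perm_seq n (s t : seq V) : size s = n -> perm_eq s t ->
  exists sigma : {perm 'I_n}, s = [seq t`_(sigma k) | k : 'I_n].
Proof.
move=> ss st; have tt : size t == n by rewrite -(perm_size st) ss.
move: st; rewrite -[t in X in X -> _]/(tval (Tuple tt)) => /tuple_permP [sigma sE].
by exists sigma; rewrite sE; apply: eq_image => // k; rewrite (tnth_nth 0).
Qed.

(* Comparing [p (2 t)] and [2 ^ m * p t] kills the leading coefficient. *)
Lemma polynomial_coef0 {W : lmodType R} (m : nat) (d : nat -> W) :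
  (forall t : R, \sum_(j < m) t ^+ j *: d j = 0) -> forall j, (j < m)%N -> d j = 0.
Proof.
elim: m d => [//|m IH] d H.
have dm j : (j < m)%N -> d j = 0.
  move=> jm; have : (2 ^+ j - 2 ^+ m : R) *: d j = 0.
    apply: (IH (fun j => (2 ^+ j - 2 ^+ m : R) *: d j)) => // t.
    have := H (2 * t); have := H t; rewrite !big_ord_recr /= => h1 h2.
    transitivity ((\sum_(i < m) (2 * t) ^+ i *: d i + (2 * t) ^+ m *: d m) -
       2 ^+ m *: (\sum_(i < m) t ^+ i *: d i + t ^+ m *: d m)).
      rewrite scalerDr scalerA -exprMn opprD addrACA subrr addr0 scaler_sumr -sumrB.
      apply: eq_bigr => i _; rewrite !scalerA -scalerBl exprMn; congr (_ *: _); ring.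
    by rewrite h1 h2 scaler0 subrr.
  move/eqP; rewrite scaler_eq0 => /orP [|/eqP //]; rewrite subr_eq0 => /eqP E.
  have lt2 : 1 < 2 :> R by rewrite ltr1n.
  by have := ltr_eXn2l lt2 j m; rewrite E ltxx jm.
move=> j; rewrite ltnS leq_eqVlt => /orP [/eqP ->|/dm //].
have := H 1; rewrite big_ord_recr /= expr1n scale1r big1 ?add0r // => i _.
by rewrite dm ?scaler0 //.
Qed.

Definition symmetric {W : Type} n (T : seq V -> W) : Prop :=
  forall s t, size s = n -> perm_eq s t -> T s = T t.

Lemma symmetric_cons {W : Type} n (T : seq V -> W) x :
  symmetric n.+1 T -> symmetric n (fun s => T (x :: s)).
Proof. by move=> sT s t ss st; apply: sT; rewrite /= ?ss // perm_cons. Qed.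

(** Splitting off the first variable gives [d j = dx j + dy (j - 1)]. Polarization needs only the
    coefficient of index 1; that of index 0 feeds the induction. *)
Lemma diagonal_expansion {W : lmodType R} n (T : seq V -> W) x y :
  mlin n T -> symmetric n T -> exists d : nat -> W,
  [/\ forall t : R, T (nseq n (x + t *: y)) = \sum_(j < n.+1) t ^+ j *: d j,
      d 0%N = T (nseq n x) &
      (0 < n)%N -> d 1%N = n%:R *: T (y :: nseq n.-1 x)].
Proof.
elim: n T => [|n IH] T.
  by exists (fun _ => T [::]); split=> // t; rewrite big_ord_recl big_ord0 expr0 scale1r addr0.
move=> [H1 H2] sT.
have [dx [dxE dx0 dx1]] := IH _ (H2 x) (symmetric_cons x sT).
have [dy [dyE dy0 _]] := IH _ (H2 y) (symmetric_cons y sT).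
(* Nothing is known of [dx j] for [j > n], hence the cut; [dy] is shifted by the factor [t]. *)
exists (fun j => (if (j <= n)%N then dx j else 0) + (if j is i.+1 then dy i else 0)).
split=> [t||_] /=.
- have -> : T (x + t *: y :: nseq n (x + t *: y)) =
      T (x :: nseq n (x + t *: y)) + t *: T (y :: nseq n (x + t *: y)).
    by rewrite [x + _]addrC H1 ?size_nseq // [RHS]addrC.
  rewrite dxE dyE.
  under [RHS]eq_bigr do rewrite scalerDr.
  rewrite big_split /=; congr (_ + _).
    rewrite [RHS]big_ord_recr /= ltnn scaler0 addr0.
    by apply: eq_bigr => i _; rewrite -ltnS ltn_ord.
  rewrite [RHS]big_ord_recl /= scaler0 add0r scaler_sumr.
  by apply: eq_bigr => i _; rewrite scalerA -exprS.
- by rewrite addr0.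
- rewrite dy0; case: n {IH} H1 H2 sT dx dxE dx0 dx1 dy dyE dy0 => [|n] *; first by rewrite add0r scale1r.
  rewrite /=; match goal with H : is_true (0 < n.+1)%N -> _ |- _ => rewrite H // end.
  rewrite -[n.+2]addn1 natrD scalerDl scale1r; congr (_ *: _ + _).
  match goal with H : symmetric _ T |- _ => apply: H; rewrite /= ?size_nseq // end.
  by rewrite -cat1s -[y :: x :: _]cat1s -[x :: nseq n x]cat1s -[y :: nseq n x]cat1s perm_catCA.
Qed.

(** The coefficient of [t] in [T] on the diagonal at [x + t *: y] is a nonzero multiple of
    [T (y :: nseq n x)]. So [T (y :: _)] vanishes on its diagonal too, and induction applies. *)
Lemma polarization {W : lmodType R} n (T : seq V -> W) :
  mlin n T -> symmetric n T -> (forall x, T (nseq n x) = 0) ->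
  forall s, size s = n -> T s = 0.
Proof.
elim: n T => [|n IH] T mT sT T0 s ss.
  by rewrite (size0nil ss); exact: (T0 0).
case: s ss => // y s [ss]; apply: (IH (fun s => T (y :: s))) ss.
- by have [_ +] := mT; exact.
- exact: symmetric_cons.
move=> x; have [d [dE _ d1]] := diagonal_expansion x y mT sT.
have : d 1%N = 0.
  by apply: (@polynomial_coef0 _ n.+2) => // t; rewrite -dE T0.
rewrite d1 // => /eqP; rewrite scaler_eq0 pnatr_eq0 /= => /eqP; exact.
Qed.

End Multilinear.

(** * Symmetric multilinear maps of homogeneous polynomials *)

Section SymmetricAssociate.
Context {R : realType} {V W : normedModType R}.

(** The average of [T] over all permutations of its variables, which agrees with [T] on the
    diagonal. *)
Lemma symmetric_associate_exists n (P : V -> W) : homog_poly n P -> exists T, is_sym_assoc n P T.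
Proof.
move=> [T [/mlinP mT [C TC] PT]].
exists (fun s => (n`!%:R : R)^-1 *: \sum_(sigma : {perm 'I_n}) T [seq s`_(sigma k) | k : 'I_n]).
have Pn0 (s : seq V) : 0 <= \prod_(x <- s) `|x| by apply: prodr_ge0.
split.
- apply/mlinP; apply: mlin_comp => [a x y|]; first by rewrite scalerDr !scalerA mulrC.
  by apply: mlin_sum => sigma; exact: mlin_perm.
- exists ((n`!%:R : R)^-1 * (#|{: {perm 'I_n}}|%:R * C)) => s ss.
  rewrite normrZ ger0_norm ?invr_ge0 // -!mulrA ler_wpM2l ?invr_ge0 //.
  apply: le_trans (ler_norm_sum _ _ _) _.
  have H sigma : `|T [seq s`_(fun_of_perm sigma k) | k : 'I_n]| <= C * \prod_(x <- s) `|x|.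
    rewrite -(perm_big _ (perm_seq_perm sigma ss)); apply: TC.
    by rewrite size_image card_ord.
  apply: le_trans (ler_sum _ (fun sigma _ => H sigma)) _.
  by rewrite sumr_const mulr_natl.
- move=> s t ss st; congr (_ *: _); have [tau ->] := perm_eq_perm_seq ss st.
  rewrite [RHS](reindex_inj (mulIg tau)) /=; apply: eq_bigr => sigma _; congr T.
  apply: eq_image => // k; rewrite permM /image_mem (nth_map k) ?size_enum_ord //.
  by rewrite nth_ord_enum.
- move=> x; rewrite PT.
  under eq_bigr => sigma _.
    have -> : [seq (nseq n x)`_(sigma k) | k : 'I_n] = nseq n x.
      apply: (@eq_from_nth _ 0); rewrite size_image card_ord ?size_nseq // => i ilt.
      by rewrite /image_mem (nth_map (Ordinal ilt)) ?size_enum_ord // !nth_nseq ltn_ord ilt.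
    over.
  rewrite sumr_const card_Sn -[X in _ *: X]scaler_nat scalerA mulVf ?scale1r //.
  Qed.

Lemma TP_assoc n (P : V -> W) : homog_poly n P -> is_sym_assoc n P (TP n P).
Proof. by move=> /symmetric_associate_exists; exact: ClassicalEpsilon.epsilon_spec. Qed.

Lemma sym_assoc_unique n (P : V -> W) T T' : is_sym_assoc n P T -> is_sym_assoc n P T' ->
  forall s, size s = n -> T s = T' s.
Proof.
move=> [/mlinP mT _ sT PT] [/mlinP mT' _ sT' PT'] s ss.
apply/eqP; rewrite -subr_eq0 addrC -scaleN1r; apply/eqP.
apply: (@polarization _ _ _ _ (fun s => -1 *: T' s + T s)) ss.
- exact: mlin_comb.
- by move=> u v uu uv; rewrite (sT _ _ uu uv) (sT' _ _ uu uv).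
- by move=> x; rewrite -PT -PT' scaleN1r addNr.
Qed.

Lemma sym_assoc_comb n (a : R) (P Q : V -> W) T T' :
  is_sym_assoc n P T -> is_sym_assoc n Q T' ->
  is_sym_assoc n (fun x => a *: P x + Q x) (fun s => a *: T s + T' s).
Proof.
move=> [/mlinP mT [C TC] sT PT] [/mlinP mT' [C' TC'] sT' PT']; split.
- by apply/mlinP; exact: mlin_comb.
- exists (`|a| * C + C') => s ss; apply: le_trans (ler_normD _ _) _.
  rewrite normrZ mulrDl -mulrA lerD ?TC' //; exact: ler_wpM2l (TC s ss).
- by move=> s t ss st; rewrite (sT _ _ ss st) (sT' _ _ ss st).
- by move=> x; rewrite PT PT'.
Qed.

Lemma homog_poly_comb n (a : R) (P Q : V -> W) :
  homog_poly n P -> homog_poly n Q -> homog_poly n (fun x => a *: P x + Q x).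
Proof.
move=> /TP_assoc hP /TP_assoc hQ; have [mT bT _ PT] := sym_assoc_comb a hP hQ.
by eexists; split; [exact: mT|exact: bT|exact: PT].
Qed.

(** [TP] is picked by [epsilon]; uniqueness of the symmetric associate is what makes the choice
    linear. *)
Lemma TP_comb n (a : R) (P Q : V -> W) : homog_poly n P -> homog_poly n Q ->
  forall s, size s = n -> TP n (fun x => a *: P x + Q x) s = a *: TP n P s + TP n Q s.
Proof.
move=> hP hQ s ss; have hPQ := sym_assoc_comb a (TP_assoc hP) (TP_assoc hQ).
exact: (sym_assoc_unique (TP_assoc (homog_poly_comb a hP hQ)) hPQ ss).
Qed.

End SymmetricAssociate.

(** * Separation of points by the dual *)

Section Separation.
Context {R : realType} {V : normedModType R}.
Implicit Types (p : V -> R) (x y : V).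

(** The bound by the norm keeps infima of chains finite and makes a linear member continuous. *)
Record sublinear_functional := SublinearFunctional {
  sublin :> V -> R;
  sublinD : forall x y, sublin (x + y) <= sublin x + sublin y;
  sublinZ : forall (a : R) x, 0 < a -> sublin (a *: x) <= a * sublin x;
  sublin_norm : forall x, sublin x <= `|x| }.

Lemma sublin_inj (p q : sublinear_functional) : (forall x, p x = q x) -> p = q.
Proof.
case: p q => [p p1 p2 p3] [q q1 q2 q3] /= /funext pq; subst q.
by congr SublinearFunctional; exact: Prop_irrelevance.
Qed.

Lemma sublinZE (p : sublinear_functional) (a : R) x : 0 < a -> p (a *: x) = a * p x.
Proof.
move=> a0; apply/le_anti; rewrite sublinZ //=.
have ai : 0 < a^-1 by rewrite invr_gt0.
have := sublinZ p (a *: x) ai; rewrite scalerA mulVf ?gt_eqF // scale1r.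
by rewrite ler_pdivlMl.
Qed.

Lemma sublin0 (p : sublinear_functional) : p 0 = 0.
Proof. by have := sublinZE p 0 (ltr0n R 2); rewrite scaler0; lra. Qed.

Lemma sublinN (p : sublinear_functional) x : - p (- x) <= p x.
Proof. by have := sublinD p x (- x); rewrite subrr sublin0; lra. Qed.

Lemma sublin_ge (p : sublinear_functional) x : - `|x| <= p x.
Proof. by have := sublinN p x; have := sublin_norm p (- x); rewrite normrN; lra. Qed.

Definition norm_sublin : sublinear_functional.
Proof.
apply: (@SublinearFunctional (fun x => `|x|)) => [x y|a x a0|x] //; first exact: ler_normD.
by rewrite normrZ gtr0_norm.
Defined.

(** [q x] is the infimum over [t >= 0] of [p (x + t *: x0) - t * p x0]. Applied to the norm it fixes
    the value at [x0]; applied to a minimal functional it forces oddness. *)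
Lemma sublin_lower (p : sublinear_functional) x0 : exists q : sublinear_functional,
  (forall x, q x <= p x) /\ q (- x0) <= - p x0.
Proof.
pose A x := [set - (p (x + t *: x0) - t * p x0) | t in [set t : R | 0 <= t]].
have AP x : [/\ forall a, A x a -> a <= sup (A x),
      forall m, (forall a, A x a -> a <= m) -> sup (A x) <= m &
      forall e, 0 < e -> exists2 a, A x a & sup (A x) - e < a].
  apply: (@real_lub _ _ (p (- x))).
    by exists (- (p (x + 0 *: x0) - 0 * p x0)), 0 => //=.
  move=> _ [t /= t0 <-].
  have : t * p x0 = p (t *: x0).
    have [->|t1] := eqVneq t 0; first by rewrite scale0r sublin0 mul0r.
    by rewrite sublinZE // lt_neqAle eq_sym t1.
  by have := sublinD p (x + t *: x0) (- x); rewrite addrAC subrr add0r; lra.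
pose q x := - sup (A x).
have qle x (t : R) : 0 <= t -> q x <= p (x + t *: x0) - t * p x0.
  move=> t0; rewrite /q lerNl; have [u _ _] := AP x; apply: u; by exists t.
have qnear x (e : R) : 0 < e -> exists2 t : R, 0 <= t & p (x + t *: x0) - t * p x0 <= q x + e.
  move=> e0; have [_ _ /(_ e e0) [_ [t t0 <-] h]] := AP x.
  by exists t => //; rewrite /q; lra.
have qp x : q x <= p x by have := qle x 0 (lexx _); rewrite scale0r addr0 mul0r subr0.
have qD x y : q (x + y) <= q x + q y.
  apply/ler_addgt0Pr => e e0; have e2 : 0 < e / 2 by lra.
  have [t t0 ht] := qnear x _ e2; have [s s0 hs] := qnear y _ e2.
  have := qle (x + y) _ (addr_ge0 t0 s0).
  by have := sublinD p (x + t *: x0) (y + s *: x0); rewrite addrACA -scalerDl; lra.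
have qZ (a : R) x : 0 < a -> q (a *: x) <= a * q x.
  move=> a0; apply/ler_addgt0Pr => e e0; have ea : 0 < e / a by rewrite divr_gt0.
  have [t t0 ht] := qnear x _ ea.
  have := qle (a *: x) _ (mulr_ge0 (ltW a0) t0); rewrite -scalerA -scalerDr sublinZE //.
  move: ht; rewrite -(ler_pM2l a0) => ht.
  have : a * (q x + e / a) = a * q x + e by rewrite mulrDr mulrCA divff ?gt_eqF // mulr1.
  by lra.
exists (SublinearFunctional qD qZ (fun x => le_trans (qp x) (sublin_norm p x))) => /=.
split=> //; have := qle (- x0) 1 ler01.
by rewrite scale1r addNr sublin0 mul1r sub0r.
Qed.

Lemma minimal_sublin (p0 : sublinear_functional) : exists p : sublinear_functional,
  (forall x, p x <= p0 x) /\
  forall q : sublinear_functional, (forall x, q x <= p x) -> forall x, p x = q x.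
Proof.
pose T := {p : sublinear_functional | forall x, p x <= p0 x}.
(* The order is reversed, so a maximal element for Zorn's lemma is a minimal functional. *)
pose r (p q : T) := `[< forall x, sval q x <= sval p x >].
have [|||A Atot|[p pp0] pmin] := @Zorn T r.
- by move=> t; apply/asboolP.
- move=> t s u /asboolP st /asboolP tu; apply/asboolP => x; exact: le_trans (tu x) (st x).
- move=> [s s0] [t t0] /asboolP st /asboolP ts; apply: eq_exist => /=.
  by apply: sublin_inj => x; apply/le_anti; rewrite ts st.
- have [[a0 Aa0]|An] := pselect (A !=set0); last first.
    have t0 : T by exists p0.
    by exists t0 => s As; exfalso; apply: An; exists s.
  pose B x := [set - (sval a : sublinear_functional) x | a in A].
  have BP x : [/\ forall a, B x a -> a <= sup (B x),
      forall m, (forall a, B x a -> a <= m) -> sup (B x) <= m &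
      forall e, 0 < e -> exists2 a, B x a & sup (B x) - e < a].
    apply: (@real_lub _ _ `|x|); first by exists (- (sval a0 : sublinear_functional) x), a0.
    by move=> _ [a _ <-]; have := sublin_ge (sval a) x; lra.
  pose q x := - sup (B x).
  have qle a x : A a -> q x <= (sval a : sublinear_functional) x.
    move=> Aa; rewrite /q lerNl; have [u _ _] := BP x; apply: u; by exists a.
  have qnear x (e : R) : 0 < e -> exists2 a, A a & (sval a : sublinear_functional) x <= q x + e.
    move=> e0; have [_ _ /(_ e e0) [_ [a Aa <-] h]] := BP x.
    by exists a => //; rewrite /q; lra.
  have qD x y : q (x + y) <= q x + q y.
    apply/ler_addgt0Pr => e e0; have e2 : 0 < e / 2 by lra.
    have [a Aa ha] := qnear x _ e2; have [b Ab hb] := qnear y _ e2.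
    (* Of two members of the chain the smaller one serves at both points. *)
    have [/asboolP ab|/asboolP ba] := Atot a b Aa Ab.
      have := qle b (x + y) Ab; have := sublinD (sval b) x y; have := ab x; lra.
    have := qle a (x + y) Aa; have := sublinD (sval a) x y; have := ba y; lra.
  have qZ (c : R) x : 0 < c -> q (c *: x) <= c * q x.
    move=> c0; apply/ler_addgt0Pr => e e0; have ec : 0 < e / c by rewrite divr_gt0.
    have [a Aa ha] := qnear x _ ec; have := qle a (c *: x) Aa; rewrite sublinZE //.
    move: ha; rewrite -(ler_pM2l c0) => ha.
    have : c * (q x + e / c) = c * q x + e by rewrite mulrDr mulrCA divff ?gt_eqF // mulr1.
    by lra.
  have qn x : q x <= `|x| by apply: le_trans (qle _ x Aa0) _; exact: sublin_norm.
  have qp0 x : SublinearFunctional qD qZ qn x <= p0 x.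
    by apply: le_trans (qle _ x Aa0) _; case: a0 {Aa0} => /= a; exact.
  exists (exist _ _ qp0) => s As; apply/asboolP => x /=; exact: qle.
exists p; split=> // q qp x.
have qp0 y : q y <= p0 y by apply: le_trans (qp y) (pp0 y).
have E : exist _ q qp0 = exist _ p pp0 :> T by apply: pmin; apply/asboolP.
by have := f_equal (fun t : T => sublin (sval t) x) E.
Qed.

(** Hahn-Banach through minimality: a minimal sublinear functional is odd, hence linear. Below [p0]
    it takes at [- x0] a value at most minus the norm of [x0]. *)
Lemma dual_separates x0 : (forall z, dual z -> z x0 = 0) -> x0 = 0.
Proof.
move=> H; have [p0 [_ p0x]] := sublin_lower norm_sublin x0.
have [p [pp0 pmin]] := minimal_sublin p0.
have pN x : p (- x) = - p x.
  have [q [qp qx]] := sublin_lower p x; have := pmin q qp (- x).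
  by have := sublinN p x; lra.
have pD x y : p (x + y) = p x + p y.
  apply/le_anti; rewrite sublinD /=; have := sublinD p (- x) (- y).
  by rewrite -opprD !pN; lra.
have pZ (a : R) x : p (a *: x) = a * p x.
  have [a0|a0|<-] := ltgtP 0 a; first exact: sublinZE.
    by rewrite -{1}[a]opprK scaleNr pN sublinZE ?oppr_gt0 // mulNr opprK.
  by rewrite scale0r sublin0 mul0r.
have dp : dual p.
  apply: (@dual_intro _ _ _ 1) => [a x y|x]; first by rewrite pD pZ.
  by rewrite mul1r ler_norml sublin_norm sublin_ge.
have := pp0 (- x0); rewrite pN H // oppr0 => h; apply/eqP; rewrite -normr_le0.
by move: p0x => /= p0x; lra.
Qed.

End Separation.

(** * The Arens extension along a lattice isomorphism *)

Section Extension.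
Context {R : realType} {E F : completeNormedModType R}.
Context {leE : E -> E -> Prop} {leF : F -> F -> Prop} {phi : (E -> R) -> (F -> R)}.
Hypothesis HE : banach_lattice leE.
Hypothesis HF : banach_lattice leF.
Hypothesis HOC : dual_order_continuous leE.
Hypothesis Hphi : lattice_iso leE leF phi.
Implicit Types (f g : E -> R) (x : E) (y : F).

Lemma phi_dual f : dual f -> dual (phi f).
Proof. by have [+ _ _ _ _] := Hphi; exact. Qed.

Lemma phi_comb (a : R) f g y : dual f -> dual g ->
  phi (fun x => a * f x + g x) y = a * phi f y + phi g y.
Proof. by move=> df dg; have [_ H _ _ _] := Hphi; rewrite H. Qed.

Lemma phi_zero y : phi (fun _ => 0) y = 0.
Proof.
have d0 := @dual_zero R E; have := phi_comb (-1) y d0 d0.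
have -> : (fun x : E => -1 * 0 + 0 : R) = (fun _ => 0).
  by apply/funext => x; rewrite mulr0 addr0.
by lra.
Qed.

(** Positivity says that [f] is the join of [0] and [f], and [phi] preserves joins. *)
Lemma phi_ge0 f : dual f -> dual_le leE (fun _ => 0) f -> dual_le leF (fun _ => 0) (phi f).
Proof.
move=> df f0; have [_ _ _ _ H] := Hphi.
have [|_ [ub _]] := H (fun _ => 0) f f (@dual_zero R E) df.
  split=> //; split=> [_ [->|->]//|u _ Hu]; by apply: Hu; right.
move=> y y0; rewrite -[X in X <= _](phi_zero y); apply: ub => //; by left.
Qed.

Lemma phi_mono f g : dual f -> dual g -> dual_le leE f g -> dual_le leF (phi f) (phi g).
Proof.
move=> df dg fg y y0; have := phi_ge0 (dual_sub dg df) _ y0.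
have -> : (fun x => g x - f x) = (fun x => -1 * f x + g x).
  by apply/funext => x; rewrite mulN1r addrC.
rewrite phi_comb // mulN1r addrC subr_ge0; apply=> x x0.
by rewrite mulN1r addrC subr_ge0; exact: fg.
Qed.

(* If this failed there would be [f_k >= 0] in the unit ball with
   [||phi f_k|| > 4 ^ k], and [phi] of [sum_k f_k / 2 ^ k] would be unbounded. *)
Lemma phi_bounded_cone : exists2 K : R, 0 < K & forall f y, dual f ->
  dual_le leE (fun _ => 0) f -> (forall x, `|f x| <= `|x|) -> leF 0 y ->
  phi f y <= K * `|y|.
Proof.
apply: contrapT => H.
have /choice [fy fyP] : forall k : nat, exists fy : (E -> R) * F,
    [/\ dual fy.1, dual_le leE (fun _ => 0) fy.1, forall x, `|fy.1 x| <= `|x|, leF 0 fy.2 &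
     4 ^+ k * `|fy.2| < phi fy.1 fy.2].
  move=> k; apply: contrapT => Hk; apply: H; exists (4 ^+ k); first by rewrite exprn_gt0.
  move=> f y df f0 f1 y0; rewrite leNgt; apply/negP => h.
  by apply: Hk; exists (f, y).
pose f k := (fy k).1; pose y k := (fy k).2.
have df k : dual (f k) by have [] := fyP k.
have f0 k x : leE 0 x -> 0 <= f k x by have [_ + _ _ _] := fyP k; exact.
have f1 k x : f k x <= `|x| by have [_ _ + _ _] := fyP k => h; exact: le_trans (ler_norm _) (h x).
have y0 k : leF 0 (y k) by have [] := fyP k.
pose g k x := 2^-1 ^+ k * f k x.
have dg k : dual (g k) by exact: dual_scale.
have h0 k : 0 <= 2^-1 ^+ k :> R by rewrite exprn_ge0.
have g0 k x : leE 0 x -> 0 <= g k x by move=> x0; rewrite mulr_ge0 // f0.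
have sum_le M x : \sum_(0 <= j < M) g j x <= 2 * `|x| - 2 * `|x| * 2^-1 ^+ M.
  elim: M => [|M IH]; first by rewrite big_geq // expr0; lra.
  rewrite big_nat_recr //= exprS.
  have : g M x <= 2^-1 ^+ M * `|x| by rewrite /g ler_wpM2l.
  by lra.
have sum_mono M N x : (M <= N)%N -> leE 0 x ->
    \sum_(0 <= j < M) g j x <= \sum_(0 <= j < N) g j x.
  move=> MN x0; rewrite (big_cat_nat (leq0n M) MN) /= lerDl.
  by apply: sumr_ge0 => j _; exact: g0.
pose A := [set h | exists M : nat, h = fun x => \sum_(0 <= j < M) g j x].
have [||||s ds [s0 sA _]] := directed_sup HE (A := A) (C := 2).
- by exists (fun x => \sum_(0 <= j < 0) g j x), 0%N.
- move=> _ [M ->]; split; first exact: dual_sum.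
  by move=> x x0; apply: sumr_ge0 => j _; exact: g0.
- move=> _ _ [M ->] [N ->]; exists (fun x => \sum_(0 <= j < maxn M N) g j x).
  split; first by exists (maxn M N).
    by move=> x x0; apply: sum_mono => //; exact: leq_maxl.
  by move=> x x0; apply: sum_mono => //; exact: leq_maxr.
- move=> _ x [M ->] x0; apply: le_trans (sum_le M x) _.
  by have := h0 M; have := normr_ge0 x => ? ?; rewrite lerBlDr lerDl !mulr_ge0.
have gs k : dual_le leE (g k) s.
  move=> x x0; apply: le_trans (sA _ (ex_intro _ k.+1 erefl) x x0).
  by rewrite big_nat_recr //= lerDr; apply: sumr_ge0 => j _; exact: g0.
have [C C0 sC] := dual_bounded (phi_dual ds).
(* This [k] has [C <= 2 ^ k], whereas the bound on [phi s] at [y k] yields [2 ^ k < C]. *)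
have [k] := half_powers_small C (ltr01 : 0 < 1 :> R).
apply/negP; rewrite -ltNge.
have [_ _ _ _ fk] := fyP k; rewrite -/(f k) -/(y k) in fk.
have phig : phi (g k) (y k) = 2^-1 ^+ k * phi (f k) (y k).
  have := phi_comb (2^-1 ^+ k) (y k) (df k) (@dual_zero R E); rewrite phi_zero addr0 => <-.
  by congr (phi _ _); apply/funext => x; rewrite addr0.
have h1 := phi_mono (dg k) ds (gs k) (y0 k).
have h2 : phi s (y k) <= C * `|y k| := le_trans (ler_norm _) (sC (y k)).
have hp : 0 < 2^-1 ^+ k :> R by rewrite exprn_gt0.
have h3 : 2^-1 ^+ k * (4 ^+ k * `|y k|) < C * `|y k|.
  by apply: lt_le_trans h2; apply: lt_le_trans h1; rewrite phig ltr_pM2l.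
have yk : 0 < `|y k|.
  rewrite lt_neqAle normr_ge0 andbT eq_sym; apply/eqP => yk0; move: h3.
  by rewrite yk0 !mulr0 ltxx.
move: h3; rewrite mulrA -exprMn ltr_pM2r // (_ : 2^-1 * 4 = 2 :> R); last by field.
move=> h3; rewrite exprVn ltr_pdivlMr ?exprn_gt0 // mul1r //.
Qed.

Lemma phi_bounded : exists2 K : R, 0 < K & forall f M y, dual f -> 0 <= M ->
  (forall x, `|f x| <= M * `|x|) -> `|phi f y| <= K * M * `|y|.
Proof.
have [K K0 HK] := phi_bounded_cone.
have scaled f M y : dual f -> dual_le leE (fun _ => 0) f -> 0 <= M ->
    (forall x, `|f x| <= M * `|x|) -> leF 0 y -> phi f y <= K * M * `|y|.
  move=> df f0 M0 fM y0; have [M1|M1] := eqVneq M 0.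
    have -> : f = fun _ => 0.
      apply/funext => x; apply/eqP; rewrite -normr_le0; apply: le_trans (fM x) _.
      by rewrite M1 mul0r.
    by rewrite phi_zero M1 mulr0 mul0r.
  have Mp : 0 < M by rewrite lt_neqAle eq_sym M1.
  have := HK (fun x => M^-1 * f x) y (dual_scale _ df) _ _ y0.
  have -> : phi (fun x => M^-1 * f x) y = M^-1 * phi f y.
    have := phi_comb M^-1 y df (@dual_zero R E); rewrite phi_zero addr0 => <-.
    by congr (phi _ _); apply/funext => x; rewrite addr0.
  rewrite ler_pdivrMl // mulrCA mulrA; apply=> [x x0|x].
    by rewrite mulr_ge0 ?invr_ge0 // f0.
  by rewrite normrM normfV (ger0_norm M0) ler_pdivrMl.
(* The parts of [f] have bounds [M] and [2 * M], which gives [2 * K * M] on the cone; splitting [y]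
   doubles it again. *)
exists (4 * K); first by rewrite mulr_gt0.
move=> f M y df M0 fM.
have [p dp [p0 fp pnear]] := dual_pos_part HE df.
have pM x : leE 0 x -> p x <= M * `|x|.
  move=> x0; apply/ler_addgt0Pr => e e0; have [z [z0 zx pz]] := pnear x e x0 e0.
  apply: le_trans pz _; rewrite lerD2r; apply: le_trans (ler_norm _) _.
  by apply: le_trans (fM z) _; apply: ler_wpM2l => //; exact: (norm_mono HE).
have dq := dual_sub dp df.
have q0 : dual_le leE (fun _ => 0) (fun x => p x - f x).
  by move=> x x0; rewrite subr_ge0; exact: fp.
have qM x : leE 0 x -> p x - f x <= 2 * M * `|x|.
  move=> x0; have := pM x x0; have := fM x; rewrite ler_norml => /andP [? _]; lra.
have M20 : 0 <= 2 * M by lra.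
have pB := dual_ge0_bound HE dp p0 pM M0.
have qB := dual_ge0_bound HE dq q0 qM M20.
have phiE z : phi f z = phi p z - phi (fun x => p x - f x) z.
  have := phi_comb (-1) z dq dp; rewrite mulN1r addrC => <-.
  by congr (phi _ _); apply/funext => x; ring.
have cone z : leF 0 z -> `|phi f z| <= 2 * K * M * `|z|.
  move=> z0; have a1 := scaled p M z dp p0 M0 pB z0.
  have a2 := scaled _ _ z dq q0 M20 qB z0.
  have b1 := phi_ge0 dp p0 z0; have b2 := phi_ge0 dq q0 z0.
  have t : 0 <= K * M * `|z| by rewrite !mulr_ge0 // ltW.
  by rewrite phiE ler_norml; apply/andP; split; lra.
have [a [b [yE a0 b0 ay by_]]] := pos_neg_parts HF y.
rewrite {1}yE (dualB _ _ (phi_dual df)); apply: le_trans (ler_normB _ _) _.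
have KM : 0 <= 2 * K * M by rewrite !mulr_ge0 // ltW.
have := le_trans (cone a a0) (ler_wpM2l KM ay).
have := le_trans (cone b b0) (ler_wpM2l KM by_).
lra.
Qed.

Definition phi_ev y : (E -> R) -> R := fun f => phi f y.

Lemma phi_ev_positive y : leF 0 y -> positive_functional leE (phi_ev y).
Proof.
move=> y0; split=> [a f g|f df f0|]; first exact: phi_comb.
  exact: phi_ge0.
have [K K0 HK] := phi_bounded; exists (K * `|y| + 1).
  by rewrite ltr_wpDl // mulr_ge0 // ltW.
move=> f M df M0 fM; apply: le_trans (HK f M y df M0 fM) _.
by rewrite mulrDl mul1r mulrAC lerDl.
Qed.

(** Allowing distinct points gives an [n]-linear form on [F] whose diagonal is [phibar]. *)
Definition arens_phi (B : seq E -> R) (ys : seq F) : R :=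
  arens B [seq phi_ev y | y <- ys].

Definition bounded_form n (C : R) (B : seq E -> R) : Prop :=
  [/\ mlin n (B : seq E -> R^o), 0 <= C &
      forall s, size s = n -> `|B s| <= C * \prod_(x <- s) `|x|].

Lemma bounded_form_cons n C B x : bounded_form n.+1 C B ->
  bounded_form n (C * `|x|) (fun s => B (x :: s)).
Proof.
move=> [[_ mB] C0 BC]; split; [exact: mB|by rewrite mulr_ge0|move=> s ss].
by have := BC (x :: s); rewrite /= ss big_cons mulrA; apply.
Qed.

Lemma bounded_form_comb n (a : R) C C' B B' : bounded_form n C B -> bounded_form n C' B' ->
  bounded_form n (`|a| * C + C') (fun s => a * B s + B' s).
Proof.
move=> [mB C0 BC] [mB' C'0 BC']; split.
- exact: (mlin_comb (W := R^o)).
- by rewrite addr_ge0 // mulr_ge0.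
- move=> s ss; apply: le_trans (ler_normD _ _) _.
  by rewrite normrM mulrDl -mulrA lerD ?BC' //; apply: ler_wpM2l => //; exact: BC.
Qed.

Lemma arens_phi_ext n B B' ys : size ys = n -> (forall s, size s = n -> B s = B' s) ->
  arens_phi B ys = arens_phi B' ys.
Proof.
rewrite /arens_phi; elim: ys n B B' => [|y ys IH] n B B' <- BB' /=; first exact: BB'.
congr (phi _ y); apply/funext => x; apply: (IH (size ys)) => // s ss.
by apply: BB'; rewrite /= ss.
Qed.

(** Linearity and the bound need a joint induction: [phi] is linear only on dual functionals, and
    that the inner function of [x] is one follows from both properties at the previous level. *)
Lemma arens_phi_comb_bound n : exists2 D : R, 0 <= D &
  (forall (a : R) C C' B B' ys, bounded_form n C B -> bounded_form n C' B' -> size ys = n ->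
     arens_phi (fun s => a * B s + B' s) ys = a * arens_phi B ys + arens_phi B' ys) /\
  (forall C B ys, bounded_form n C B -> size ys = n ->
     `|arens_phi B ys| <= C * D * \prod_(y <- ys) `|y|).
Proof.
have [K K0 HK] := phi_bounded.
elim: n => [|n [D D0 [IHl IHb]]].
  exists 1 => //; split=> [a C C' B B' ys _ _ /size0nil -> //|C B ys [_ _ BC] /size0nil ->].
  by have := BC [::] erefl; rewrite /arens_phi /= !big_nil !mulr1.
have dualA C B ys : bounded_form n.+1 C B -> size ys = n ->
    dual (fun x => arens_phi (fun s => B (x :: s)) ys) /\
    forall x, `|arens_phi (fun s => B (x :: s)) ys| <= C * D * (\prod_(y <- ys) `|y|) * `|x|.
  move=> bB ss; have bd x : `|arens_phi (fun s => B (x :: s)) ys| <=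
      C * D * (\prod_(y <- ys) `|y|) * `|x|.
    apply: le_trans (IHb _ _ _ (bounded_form_cons x bB) ss) _.
    by rewrite [leRHS]mulrC !mulrA [`|x| * C]mulrC.
  split=> //; apply: dual_intro bd => a x x'.
  rewrite -(IHl a _ _ _ _ _ (bounded_form_cons x bB) (bounded_form_cons x' bB) ss).
  by apply: (arens_phi_ext ss) => s sn; have [[mB _] _ _] := bB; exact: mB.
exists (K * D); first by rewrite mulr_ge0 // ltW.
split=> [a C C' B B' [|y ys] // bB bB' [ss]|C B [|y ys] // bB [ss]].
- have [d1 _] := dualA _ _ _ bB ss; have [d2 _] := dualA _ _ _ bB' ss.
  rewrite /arens_phi /= -/(arens_phi _ _) /phi_ev -phi_comb //.
  congr (phi _ y); apply/funext => x.
  exact: IHl (bounded_form_cons x bB) (bounded_form_cons x bB') ss.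
- have [d1 b1] := dualA _ _ _ bB ss; have [_ C0 _] := bB.
  have P0 : 0 <= C * D * (\prod_(y <- ys) `|y|) by rewrite !mulr_ge0 // prodr_ge0.
  apply: le_trans (HK _ _ y d1 P0 b1) _; rewrite big_cons.
  by rewrite le_eqVlt; apply/orP; left; apply/eqP; ring.
Qed.

Lemma arens_phi_comb n (a : R) C C' B B' ys :
  bounded_form n C B -> bounded_form n C' B' -> size ys = n ->
  arens_phi (fun s => a * B s + B' s) ys = a * arens_phi B ys + arens_phi B' ys.
Proof. by have [D _ [H _]] := arens_phi_comb_bound n; exact: H. Qed.

Lemma arens_phi_bound n : exists2 D : R, 0 <= D & forall C B ys,
  bounded_form n C B -> size ys = n -> `|arens_phi B ys| <= C * D * \prod_(y <- ys) `|y|.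
Proof. by have [D D0 [_ H]] := arens_phi_comb_bound n; exists D. Qed.

Lemma arens_phi_dual n C B ys : bounded_form n.+1 C B -> size ys = n ->
  dual (fun x => arens_phi (fun s => B (x :: s)) ys).
Proof.
move=> bB ss; have [D D0 HD] := arens_phi_bound n.
apply: (@dual_intro _ _ _ (C * D * \prod_(y <- ys) `|y|)) => [a x x'|x].
  rewrite -(arens_phi_comb a (bounded_form_cons x bB) (bounded_form_cons x' bB) ss).
  by apply: (arens_phi_ext ss) => s sn; have [[mB _] _ _] := bB; exact: mB.
apply: le_trans (HD _ _ _ (bounded_form_cons x bB) ss) _.
by rewrite [leRHS]mulrC !mulrA [`|x| * C]mulrC.
Qed.

Lemma arens_phi_cons B y ys :
  arens_phi B (y :: ys) = phi (fun x => arens_phi (fun s => B (x :: s)) ys) y.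
Proof. by []. Qed.

Lemma mlin_functional n (psi : (E -> R) -> R) (A : E -> seq F -> R) :
  (forall (a : R) f g, dual f -> dual g -> psi (fun x => a * f x + g x) = a * psi f + psi g) ->
  (forall x, mlin n (A x : seq F -> R^o)) ->
  (forall ys, size ys = n -> dual (A^~ ys)) ->
  mlin n ((fun ys => psi (A^~ ys)) : seq F -> R^o).
Proof.
move=> psil; elim: n A => [//|n IH] A mA dA; split=> [ys ss a y y'|y].
  rewrite -[RHS]/(a * psi _ + psi _) -psil; try by apply: dA; rewrite /= ss.
  by congr psi; apply/funext => x; have [mAx _] := mA x; exact: mAx.
apply: (IH (fun x ys => A x (y :: ys))) => [x|ys ss]; first by have [_] := mA x; exact.
by apply: dA; rewrite /= ss.
Qed.

Lemma arens_phi_mlin n C B : bounded_form n C B -> mlin n (arens_phi B : seq F -> R^o).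
Proof.
elim: n C B => [//|n IH] C B bB; split=> [ys ss a y y'|y].
  by rewrite !arens_phi_cons (dualP _ _ _ (phi_dual (arens_phi_dual bB ss))).
apply: (@mlin_functional n (phi_ev y) (fun x ys => arens_phi (fun s => B (x :: s)) ys)).
- by move=> a f g; exact: phi_comb.
- by move=> x; exact: IH (bounded_form_cons x bB).
- by move=> ys ss; exact: arens_phi_dual bB ss.
Qed.

Definition positive_form n (B : seq E -> R) : Prop :=
  forall s, size s = n -> (forall x, x \in s -> leE 0 x) -> 0 <= B s.

Lemma positive_form_cons n B x : leE 0 x -> positive_form n.+1 B ->
  positive_form n (fun s => B (x :: s)).
Proof.
move=> x0 pB s ss s0; apply: pB; rewrite /= ?ss // => z.
by rewrite inE => /orP [/eqP ->|/s0].
Qed.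

Lemma arens_phi_ge0 n C B ys : bounded_form n C B -> positive_form n B ->
  size ys = n -> (forall y, y \in ys -> leF 0 y) -> 0 <= arens_phi B ys.
Proof.
elim: n C B ys => [|n IH] C B [|y ys] // bB pB; first by move=> _ _; exact: pB.
move=> [ss] ys0; rewrite arens_phi_cons; apply: phi_ge0.
- exact: arens_phi_dual bB ss.
- move=> x x0; apply: IH (bounded_form_cons x bB) (positive_form_cons x0 pB) ss _.
  by move=> z zys; apply: ys0; rewrite inE zys orbT.
- by apply: ys0; rewrite mem_head.
Qed.

(** Extending in the other variables leaves a positive symmetric bilinear form [b], to which the
    exchange of two positive functionals applies. *)
Lemma arens_phi_swap n C B y1 y2 ys : bounded_form n.+2 C B -> positive_form n.+2 B ->
  symmetric n.+2 B -> size ys = n -> leF 0 y1 -> leF 0 y2 -> (forall y, y \in ys -> leF 0 y) ->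
  arens_phi B (y1 :: y2 :: ys) = arens_phi B (y2 :: y1 :: ys).
Proof.
move=> bB pB sB ss y10 y20 ys0.
pose b x x' := arens_phi (fun s => B (x :: x' :: s)) ys.
have bC x x' : b x x' = b x' x.
  apply: (arens_phi_ext ss) => s sn; apply: sB; first by rewrite /= sn.
  by rewrite -cat1s -[x' :: s]cat1s -[x' :: x :: s]cat1s -[x :: s]cat1s perm_catCA.
have db x : dual (b x) by exact: arens_phi_dual (bounded_form_cons x bB) ss.
have db' x : dual (b^~ x) by have := db x; congr dual; apply/funext => x'; exact: bC.
have b0 x x' : leE 0 x -> leE 0 x' -> 0 <= b x x'.
  move=> x0 x'0; apply: arens_phi_ge0 (bounded_form_cons x' (bounded_form_cons x bB)) _ ss ys0.
  exact: positive_form_cons x'0 (positive_form_cons x0 pB).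
have [D D0 HD] := arens_phi_bound n; have [_ C0 _] := bB.
have bD x x' : `|b x x'| <= C * D * (\prod_(y <- ys) `|y|) * `|x| * `|x'|.
  apply: le_trans (HD _ _ _ (bounded_form_cons x' (bounded_form_cons x bB)) ss) _.
  by rewrite le_eqVlt; apply/orP; left; apply/eqP; ring.
have CD0 : 0 <= C * D * (\prod_(y <- ys) `|y|) by rewrite !mulr_ge0 // prodr_ge0.
have := arens_exchange HE HOC db db' b0 CD0 bD (phi_ev_positive y10) (phi_ev_positive y20).
rewrite !arens_phi_cons /phi_ev => ->.
congr (phi _ y2); apply/funext => x; congr (phi _ y1); apply/funext => x'.
exact: bC.
Qed.

(** Exchanges of the first two variables together with permutations of the tail generate all
    permutations. The tail is treated under the outer [phi], where comparing at positive [x]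
    suffices. *)
Lemma arens_phi_symmetric_cone n C B s t : bounded_form n C B -> positive_form n B ->
  symmetric n B -> size s = n -> perm_eq s t -> (forall y, y \in s -> leF 0 y) ->
  arens_phi B s = arens_phi B t.
Proof.
elim: n C B s t => [|n IH] C B [|y s] t // bB pB sB.
  by move=> _ st _; rewrite perm_sym in st; rewrite (perm_nilP st).
move=> [ss] st ys0.
have tail z u v : size u = n -> perm_eq u v -> leF 0 z -> (forall y, y \in u -> leF 0 y) ->
    arens_phi B (z :: u) = arens_phi B (z :: v).
  move=> uu uv z0 u0; have vv : size v = n by rewrite -(perm_size uv).
  rewrite !arens_phi_cons; congr (phi _ z).
  apply: (dual_eq_cone HE (arens_phi_dual bB uu) (arens_phi_dual bB vv)) => x x0.
  apply: IH (bounded_form_cons x bB) (positive_form_cons x0 pB) _ uu uv u0.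
  exact: symmetric_cons.
have y0 : leF 0 y by apply: ys0; rewrite mem_head.
have s0 z : z \in s -> leF 0 z by move=> zs; apply: ys0; rewrite inE zs orbT.
have yt : y \in t by rewrite -(perm_mem st) mem_head.
case/splitPr: yt st => [[|z t1] t2] /=; first by rewrite perm_cons => st; exact: tail.
rewrite -cat_cons -[y :: t2]cat1s perm_sym perm_catCA /= perm_cons perm_sym => st.
have z0 : leF 0 z by apply: s0; rewrite (perm_mem st) mem_head.
have w0 w : w \in t1 ++ t2 -> leF 0 w.
  by move=> xt; apply: s0; rewrite (perm_mem st) inE xt orbT.
have sz : size (t1 ++ t2) = n.-1 by rewrite -ss (perm_size st).
have n0 : (0 < n)%N by rewrite -ss (perm_size st).
case: n IH bB pB sB ss tail sz n0 => // n IH bB pB sB ss tail sz _.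
(* The path is [y :: s], then [y :: z :: t1 ++ t2], then [z :: y :: t1 ++ t2], then
   [z :: t1 ++ y :: t2]. *)
rewrite (tail y _ _ ss st y0 s0) (arens_phi_swap bB pB sB sz y0 z0 w0).
apply: tail => //; first by rewrite /= sz.
  by rewrite -cat1s perm_catCA.
by move=> w; rewrite inE => /orP [/eqP ->|/w0].
Qed.

Lemma mlin_eq_cone {W : lmodType R} n (T T' : seq F -> W) : mlin n T -> mlin n T' ->
  (forall s, size s = n -> (forall y, y \in s -> leF 0 y) -> T s = T' s) ->
  forall s, size s = n -> T s = T' s.
Proof.
elim: n T T' => [|n IH] T T' mT mT' H [|y s] // => [_|[ss]]; first exact: H.
have cone z : leF 0 z -> T (z :: s) = T' (z :: s).
  move=> z0; have [_ /(_ z) mTz] := mT; have [_ /(_ z) mTz'] := mT'.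
  apply: (IH (fun s => T (z :: s)) (fun s => T' (z :: s))) => // u uu u0.
  by apply: H; rewrite /= ?uu // => x; rewrite inE => /orP [/eqP ->|/u0].
have [p [q [-> p0 q0 _ _]]] := pos_neg_parts HF y.
have [h _] := mT; have [h' _] := mT'.
by rewrite addrC -scaleN1r h // h' // !cone.
Qed.

(** For a fixed permutation both sides are multilinear in the points, so agreement on the cone is
    enough. *)
Lemma arens_phi_symmetric n C B : bounded_form n C B -> positive_form n B ->
  symmetric n B -> symmetric n (arens_phi B).
Proof.
move=> bB pB sB s t ss st; have tt : size t = n by rewrite -(perm_size st).
have [sigma ->] := perm_eq_perm_seq ss st.
have mS := arens_phi_mlin bB.
apply: (mlin_eq_cone (mlin_perm sigma mS) mS) tt => u uu u0.
apply: arens_phi_symmetric_cone bB pB sB _ (perm_seq_perm sigma uu) _.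
  by rewrite size_image card_ord.
by move=> y; rewrite (perm_mem (perm_seq_perm sigma uu)); exact: u0.
Qed.

Lemma arens_phi_inj n C B : bounded_form n C B ->
  (forall ys, size ys = n -> arens_phi B ys = 0) -> forall s, size s = n -> B s = 0.
Proof.
elim: n C B => [|n IH] C B bB H [|x s] // => [_|[ss]]; first exact: (H [::]).
apply: (IH _ _ (bounded_form_cons x bB)) ss => ys sy.
have dA := arens_phi_dual bB sy.
have [_ _ inj _ _] := Hphi.
have /(f_equal (fun f : E -> R => f x)) // :
  (fun x => arens_phi (fun s => B (x :: s)) ys) = fun _ => 0.
apply: inj => //; first exact: dual_zero.
by apply/funext => y; rewrite -arens_phi_cons H /= ?sy // phi_zero.
Qed.

End Extension.

(** * Regular polynomials *)

Section RegularPolynomials.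
Context {R : realType} {E F G : completeNormedModType R}.
Context {leE : E -> E -> Prop} {leF : F -> F -> Prop} {leG : G -> G -> Prop}.
Context {phi : (E -> R) -> (F -> R)}.
Hypothesis HE : banach_lattice leE.
Hypothesis HF : banach_lattice leF.
Hypothesis HG : banach_lattice leG.
Hypothesis HOC : dual_order_continuous leE.
Hypothesis Hphi : lattice_iso leE leF phi.
Implicit Types (P Q : E -> G) (z : G -> R).

(** One [C] serves all [z], as a bound in the bidual norm requires. *)
Lemma scalar_form n P : homog_poly n P -> exists2 C : R, 0 <= C &
  forall z, dual z -> bounded_form n (dual_norm z * C) (fun s => z (TP n P s)).
Proof.
move=> /TP_assoc [/mlinP mT [C TC] _ _]; exists `|C| => // z dz; split.
- apply: (mlin_comp (W' := R^o)) mT => a x y; exact: dualP.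
- by rewrite mulr_ge0 // dual_norm_ge0.
- move=> s ss; have [zn _] := dual_norm_lub dz; apply: le_trans (zn _) _.
  rewrite -mulrA ler_wpM2l ?dual_norm_ge0 //; apply: le_trans (TC s ss) _.
  by rewrite ler_wpM2r ?ler_norm // prodr_ge0.
Qed.

Lemma phibar_arens n P (y : F) z :
  phibar phi n P y z = arens_phi (phi := phi) (fun s => z (TP n P s)) (nseq n y).
Proof. by rewrite /phibar /arens_phi map_nseq. Qed.

Lemma arens_phi_TP_comb n (a : R) P Q ys z : homog_poly n P -> homog_poly n Q -> dual z ->
  size ys = n ->
  arens_phi (phi := phi) (fun s => z (TP n (fun x => a *: P x + Q x) s)) ys =
  a * arens_phi (phi := phi) (fun s => z (TP n P s)) ys +
  arens_phi (phi := phi) (fun s => z (TP n Q s)) ys.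
Proof.
move=> hP hQ dz ss; have [C _ /(_ z dz) bP] := scalar_form hP.
have [C' _ /(_ z dz) bQ] := scalar_form hQ.
rewrite -(arens_phi_comb HE HF Hphi a bP bQ ss); apply: (arens_phi_ext ss) => s sn.
by rewrite TP_comb // dualP.
Qed.

Lemma phibar_comb n (a : R) P Q y : homog_poly n P -> homog_poly n Q ->
  beq (phibar phi n (fun x => a *: P x + Q x) y)
      (fun z => a * phibar phi n P y z + phibar phi n Q y z).
Proof. by move=> hP hQ z dz; rewrite !phibar_arens arens_phi_TP_comb // size_nseq. Qed.

Lemma arens_phi_functional_comb n P (a : R) z w ys : homog_poly n P -> dual z -> dual w ->
  size ys = n ->
  arens_phi (phi := phi) (fun s => a * z (TP n P s) + w (TP n P s)) ys =
  a * arens_phi (phi := phi) (fun s => z (TP n P s)) ys +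
  arens_phi (phi := phi) (fun s => w (TP n P s)) ys.
Proof.
move=> hP dz dw ss; have [C _ bP] := scalar_form hP.
exact: (arens_phi_comb HE HF Hphi a (bP z dz) (bP w dw) ss).
Qed.

(** The exchange concerns positive forms, so [z] is written as [p - (p - z)] with [p] its positive
    part. *)
Lemma pos_poly_arens_symmetric n P z : pos_poly leE leG n P -> dual z ->
  symmetric n (arens_phi (phi := phi) (fun s => z (TP n P s))).
Proof.
move=> [hP P0] dz; have [p dp [p0 zp _]] := dual_pos_part HG dz.
have dq := dual_sub dp dz; have [C _ bP] := scalar_form hP.
have sym w : dual w -> dual_le leG (fun _ => 0) w ->
    symmetric n (arens_phi (phi := phi) (fun s => w (TP n P s))).
  move=> dw w0; apply: (arens_phi_symmetric HE HF HOC Hphi (bP w dw)) => [s ss s0|s t ss st].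
    by apply: w0; exact: P0.
  by have [_ _ sT _] := TP_assoc hP; rewrite (sT s t ss st).
have zE ys : size ys = n -> arens_phi (phi := phi) (fun s => z (TP n P s)) ys =
    -1 * arens_phi (phi := phi) (fun s => p (TP n P s) - z (TP n P s)) ys +
    arens_phi (phi := phi) (fun s => p (TP n P s)) ys.
  move=> ss; rewrite -(arens_phi_functional_comb (-1) hP dq dp ss).
  by apply: (arens_phi_ext ss) => s _; ring.
move=> s t ss st; rewrite !zE -?(perm_size st) //.
rewrite (sym _ dp p0 s t ss st) (sym _ dq _ s t ss st) // => x x0.
by rewrite subr_ge0; exact: zp.
Qed.

Lemma regular_poly_comb n P : regular_poly leE leG n P -> exists P1 P2,
  [/\ pos_poly leE leG n P1, pos_poly leE leG n P2 & P = fun x => -1 *: P2 x + P1 x].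
Proof.
move=> [P1 [P2 [p1 p2 PE]]]; exists P1, P2; split=> //.
by apply/funext => x; rewrite PE scaleN1r addrC.
Qed.

Lemma regular_poly_homog n P : regular_poly leE leG n P -> homog_poly n P.
Proof. by move=> /regular_poly_comb [P1 [P2 [[h1 _] [h2 _] ->]]]; exact: homog_poly_comb. Qed.

Lemma regular_poly_arens_symmetric n P z : regular_poly leE leG n P -> dual z ->
  symmetric n (arens_phi (phi := phi) (fun s => z (TP n P s))).
Proof.
move=> /regular_poly_comb [P1 [P2 [p1 p2 ->]]] dz s t ss st.
have [[h1 _] [h2 _]] := (p1, p2).
rewrite !arens_phi_TP_comb -?(perm_size st) //.
by rewrite (pos_poly_arens_symmetric p1 dz ss st) (pos_poly_arens_symmetric p2 dz ss st).
Qed.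

Lemma multilinear2_mlin n (T : seq F -> (G -> R) -> R) z : multilinear2 n T -> dual z ->
  mlin n ((fun s => T s z) : seq F -> R^o).
Proof.
move=> mT dz; apply/mlinP => s ss i ilt a x y.
by have [_ /(_ i ilt a x y z dz)] := mT s ss.
Qed.

Lemma sym_assoc2_unique n (Q : F -> (G -> R) -> R) T T' :
  is_sym_assoc2 n Q T -> is_sym_assoc2 n Q T' -> forall s, size s = n -> beq (T s) (T' s).
Proof.
move=> [mT _ sT QT] [mT' _ sT' QT'] s ss z dz.
apply/eqP; rewrite -subr_eq0 addrC -mulN1r; apply/eqP.
apply: (@polarization _ _ R^o n (fun s => -1 *: (T' s z : R^o) + (T s z : R^o))) ss.
- by apply: mlin_comb; exact: multilinear2_mlin.
- by move=> u v uu uv; rewrite (sT _ _ uu uv z dz) (sT' _ _ uu uv z dz).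
- by move=> x; rewrite -QT // -QT' // scaleN1r addNr.
Qed.

(** Positivity of [phibar] is a statement about the map chosen by [TP2]; an explicit associate
    identifies that map by uniqueness. *)
Lemma phibar_sym_assoc2 n P : pos_poly leE leG n P ->
  is_sym_assoc2 n (phibar phi n P)
    (fun ys z => arens_phi (phi := phi) (fun s => z (TP n P s)) ys).
Proof.
move=> pP; have [hP _] := pP; have [C C0 bP] := scalar_form hP.
have [D D0 HD] := arens_phi_bound HE HF Hphi n.
split.
- move=> s ss; split=> [|i ilt a x y z dz].
    split=> [a z w dz dw|]; first exact: arens_phi_functional_comb.
    exists (C * D * \prod_(x <- s) `|x|) => z dz; apply: le_trans (HD _ _ _ (bP z dz) ss) _.
    by rewrite le_eqVlt; apply/orP; left; apply/eqP; ring.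
  by have /mlinP := arens_phi_mlin HE HF Hphi (bP z dz); apply.
- exists (C * D) => s ss z dz; apply: le_trans (HD _ _ _ (bP z dz) ss) _.
  by rewrite le_eqVlt; apply/orP; left; apply/eqP; ring.
- by move=> s t ss st z dz; exact: pos_poly_arens_symmetric.
- by move=> y z _; rewrite phibar_arens.
Qed.

Lemma phibar_pos_poly2 n P : pos_poly leE leG n P -> pos_poly2 leF leG n (phibar phi n P).
Proof.
move=> pP; have HT := phibar_sym_assoc2 pP; have [hP P0] := pP; have [mT bT _ PT] := HT.
split; first by eexists; split; [exact: mT|exact: bT|exact: PT].
have HT2 : is_sym_assoc2 n (phibar phi n P) (TP2 n (phibar phi n P)).
  by apply: ClassicalEpsilon.epsilon_spec; exists (fun ys z => arens_phi (phi := phi) (fun s => z (TP n P s)) ys).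
move=> s ss s0 z dz z0; rewrite (sym_assoc2_unique HT2 HT ss dz).
have [C _ bP] := scalar_form hP.
apply: (arens_phi_ge0 HE HF Hphi (bP z dz)) => // t tt t0.
by apply: z0; exact: P0.
Qed.

Lemma phibar_regular_poly2 n P : regular_poly leE leG n P ->
  regular_poly2 leF leG n (phibar phi n P).
Proof.
move=> /regular_poly_comb [P1 [P2 [p1 p2 ->]]]; have [[h1 _] [h2 _]] := (p1, p2).
exists (phibar phi n P1), (phibar phi n P2); split; [exact: phibar_pos_poly2..|].
by move=> y z dz; rewrite phibar_comb // mulN1r addrC.
Qed.

(** Three separations are combined: polarization passes from the diagonal to all points of [F],
    injectivity of [phi] returns to forms on [E], and the functionals [z] detect values in [G]. *)
Lemma phibar_injective n P Q : regular_poly leE leG n P -> regular_poly leE leG n Q ->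
  (forall y, beq (phibar phi n P y) (phibar phi n Q y)) -> P = Q.
Proof.
move=> rP rQ PQ; have hP := regular_poly_homog rP; have hQ := regular_poly_homog rQ.
have TPQ s : size s = n -> TP n P s = TP n Q s.
  move=> ss; apply/eqP; rewrite -subr_eq0; apply/eqP; apply: dual_separates => z dz.
  have [C _ /(_ z dz) bP] := scalar_form hP; have [C' _ /(_ z dz) bQ] := scalar_form hQ.
  rewrite dualB // addrC -mulN1r.
  apply: (arens_phi_inj HE HF Hphi (bounded_form_comb (-1) bQ bP) _ ss) => ys sy.
  rewrite (arens_phi_comb HE HF Hphi (-1) bQ bP sy).
  pose SP := arens_phi (phi := phi) (fun s => z (TP n P s)).
  pose SQ := arens_phi (phi := phi) (fun s => z (TP n Q s)).
  apply: (@polarization _ _ R^o n (fun s => -1 *: (SQ s : R^o) + (SP s : R^o))) sy.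
  - by apply: mlin_comb; [exact: (arens_phi_mlin HE HF Hphi bQ)|exact: (arens_phi_mlin HE HF Hphi bP)].
  - move=> u v uu uv; rewrite /SP /SQ (regular_poly_arens_symmetric rP dz uu uv).
    by rewrite (regular_poly_arens_symmetric rQ dz uu uv).
  - by move=> y; rewrite /SP /SQ -!phibar_arens PQ // scaleN1r addNr.
apply/funext => x; have [_ _ _ ->] := TP_assoc hP; have [_ _ _ ->] := TP_assoc hQ.
by rewrite TPQ // size_nseq.
Qed.

End RegularPolynomials.

Unset Implicit Arguments. Set Strict Implicit.

Theorem theorem2p4 (R : realType)
  (E F : completeNormedModType R) (leE : E -> E -> Prop) (leF : F -> F -> Prop)
  (phi : (E -> R) -> (F -> R)) :
  banach_lattice leE -> banach_lattice leF ->
  dual_order_continuous leE ->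
  lattice_iso leE leF phi ->
  forall (n : nat), (0 < n)%N ->
  forall (G : completeNormedModType R) (leG : G -> G -> Prop),
    banach_lattice leG -> dedekind_complete leG ->
    [/\ (* phi-bar maps P^r(nE;G) into P^r(nF;G^** ) *)
        (forall P : E -> G, regular_poly leE leG n P ->
           regular_poly2 leF leG n (phibar phi n P)),
        (* linear *)
        (forall (a : R) (P Q : E -> G),
           regular_poly leE leG n P -> regular_poly leE leG n Q ->
           forall y, beq (phibar phi n (fun x => a *: P x + Q x) y)
                         (fun z => a * phibar phi n P y z + phibar phi n Q y z)),
        (* positive *)
        (forall P : E -> G, pos_poly leE leG n P ->
           pos_poly2 leF leG n (phibar phi n P)) &
        (* injective, i.e. a linear isomorphism onto its image *)
        (forall P Q : E -> G,
           regular_poly leE leG n P -> regular_poly leE leG n Q ->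
           (forall y, beq (phibar phi n P y) (phibar phi n Q y)) -> P = Q)].
Proof.
move=> HE HF HOC Hphi n n0 G leG HG _; split.
- by move=> P; exact: phibar_regular_poly2.
- move=> a P Q /regular_poly_homog hP /regular_poly_homog hQ y.
  exact: (phibar_comb HE HF Hphi).
- by move=> P; exact: phibar_pos_poly2.
- by move=> P Q; exact: (phibar_injective HE HF HG HOC Hphi).
Qed.
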